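(* There exists a constant $c>0$ such that for all integers $n\ge2$, $1\le k\le n$ and $1\le d\le\binom{n-1}{k-1}$ such that $nd$ is divisible by $k$ and $\min\left(\frac{nd}{k},\binom{n}{k}-\frac{nd}{k}\right)\ge n^c$, the number of $d$-regular, $k$-uniform hypergraphs on $n$ vertices equals $$\frac{1}{(2\pi p(1-p))^{\frac n2}\,p^{\frac{nd}{k}}(1-p)^{\binom nk-\frac{nd}{k}}}\left(\frac{k}{\binom{n-1}{k-1}}\right)^{\frac12}\left(\frac{1}{\binom{n-2}{k-1}}\right)^{\frac12(n-1)}(1+\delta),$$ where $p:=\frac{nd}{k\binom nk}$ and $$|\delta|\le\frac{n^c}{\sqrt{\min\left(\frac{nd}{k},\binom nk-\frac{nd}{k}\right)}}.$$
   Context: A (simple) $k$-uniform hypergraph on $n$ vertices is a family of distinct sets of size $k$ (edges) of elements of $\{1,\ldots,n\}$ (vertices); vertices are labelled. It is $d$-regular if each vertex belongs to exactly $d$ edges. The constant $c$ does not depend on any of the other parameters. *)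

(* Defs.v *)
From mathcomp Require Import all_boot all_order all_algebra.
From mathcomp Require Import reals exp trigo.

Set Implicit Arguments.
Unset Strict Implicit.
Unset Printing Implicit Defensive.

Import Order.TTheory GRing.Theory Num.Theory.

(* Simple hypergraphs on the labelled vertex set 'I_n, represented by their
   edge sets. *)
Definition uniform_hypergraph (n k : nat) (H : {set {set 'I_n}}) : bool :=
  [forall e in H, #|e| == k].

Definition regular_hypergraph (n d : nat) (H : {set {set 'I_n}}) : bool :=
  [forall v : 'I_n, #|[set e in H | v \in e]| == d].

Definition num_regular_uniform (n k d : nat) : nat :=
  #|[set H : {set {set 'I_n}} |
      uniform_hypergraph k H && regular_hypergraph d H]|.

(* Natural-number division and subtraction are both exact in the range of
   interest: see edge_countK and edge_count_le. *)
Definition edge_count (n k d : nat) : nat := (n * d) %/ k.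

Definition nonedge_count (n k d : nat) : nat := 'C(n, k) - edge_count n k d.

Lemma edge_countK (n k d : nat) :
  k %| n * d -> edge_count n k d * k = n * d.
Proof. exact: divnK. Qed.

Lemma edge_count_le (n k d : nat) :
  0 < n -> 0 < k -> d <= 'C(n - 1, k - 1) -> edge_count n k d <= 'C(n, k).
Proof.
case: n => [//|n]; case: k => [//|k] _ _; rewrite !subn1 /= => le_d.
rewrite /edge_count -(mulKn 'C(n.+1, k.+1) (ltn0Sn k)).
by rewrite leq_div2r // -mul_bin_diag leq_mul2l le_d orbT.
Qed.

Local Open Scope ring_scope.

Definition edge_density (R : realType) (n k d : nat) : R :=
  (n * d)%:R / (k%:R * 'C(n, k)%:R).

Definition asymptotic_count (R : realType) (n k d : nat) : R :=
  let p := edge_density R n k d in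
  ((2 * pi * p * (1 - p)) `^ (n%:R / 2)
    * p ^+ edge_count n k d
    * (1 - p) ^+ nonedge_count n k d)^-1
  * (k%:R / 'C(n - 1, k - 1)%:R) `^ (1 / 2)
  * (1 / 'C(n - 2, k - 1)%:R) `^ (1 / 2 * (n - 1)%:R).

(* Main.v *)
(* Put the variable theta_i on each vertex i and let y_e be the sum of theta_i
   over an edge e, where the last vertex counts as a member of every edge.
   Summing over all theta in a fine grid on the torus the product over the
   k-sets e of the centred Bernoulli(p) characteristic functions at y_e isolates,
   by Fourier inversion, the hypergraphs with the prescribed number of edges and
   the prescribed degrees. The product is compared with exp(-Q/2), where
   Q = p (1-p) \sum_e y_e^2: near the origin by Taylor expansion, and away from it
   both are negligible, because swapping a vertex of an edge for the last vertex
   bounds every theta_i by the y_e. Completing squares one variable at a time makes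
   Q triangular, so that the sum of exp(-Q/2) over the grid becomes an iterated
   one-dimensional Gaussian sum, whose value is the asymptotic formula.
   Indices are shifted: there are n.+1 vertices and the edges have k.+1 elements. *)
Require Import Defs.
From mathcomp Require Import all_boot all_order all_algebra.
From mathcomp Require Import all_classical all_reals all_analysis.
From mathcomp Require Import complex ring lra zify.

Set Implicit Arguments.
Unset Strict Implicit.
Unset Printing Implicit Defensive.

Import Order.TTheory GRing.Theory Num.Theory.
Import numFieldNormedType.Exports Normc.
Local Open Scope ring_scope.

(** The error budget rests on one comparison. With [V = p (1-p) C(n,k)], every phase is at most a
    power of n times sqrt(Q/V). The cubic Taylor errors, summed over a possibly exponential number
    of edges, are then at most a power of n times Q^(3/2) / sqrt V relative to the Gaussian, and a
    slight damping of exp(-Q/2) absorbs the factor Q^(3/2). Since V is comparable with the smaller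
    of the numbers of edges and non-edges, every other loss may also be a power of n over sqrt V, so
    crude bounds suffice throughout and the final constant only has to cover them. A grid in place
    of an integral makes Fourier inversion an exact finite identity. A linear change of variables
    would not preserve the grid; instead the variables are summed out one at a time, which works
    because a one-dimensional Gaussian sum hardly depends on the offset of its grid. *)

Lemma is_derive_mvt (R : realType) (f df : R -> R) (a b : R) :
  a <= b -> (forall x, x \in `[a, b] -> is_derive x 1 f (df x)) ->
  exists2 y, y \in `[a, b] & f b - f a = df y * (b - a).
Proof.
move=> ab fd.
have fo x : x \in `]a, b[ -> is_derive x 1 f (df x).
  by move=> xab; apply: fd; apply: subset_itv_oo_cc xab.
have fc : {within `[a, b], continuous f}%classic.
  apply: derivable_within_continuous => x xab.
  by case: (fd x xab).
exact: MVT_segment fo fc.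
Qed.

(** * Gaussian sums over one-dimensional grids *)

Section gauss_primitive.
Local Open Scope classical_set_scope.
Local Open Scope ring_scope.
Variable R : realType.
Local Notation mu := (@lebesgue_measure R).
Implicit Types (F : R -> R) (x y a h c : R).

Lemma exists_gauss_primitive : exists F : R -> R,
  [/\ forall x, is_derive x 1 F (gauss_fun x), forall x, F (- x) = - F x
    & F x @[x --> +oo] --> Num.sqrt pi / 2].
Proof.
pose I x := (\int[mu]_(t in [set` `]-oo, x]]) gauss_fun t)%R.
have dI x : is_derive x 1 I (gauss_fun x).
  have x1 : x < x + 1 by rewrite ltrDl.
  have ix : mu.-integrable [set` `]-oo, x + 1]] (EFin \o @gauss_fun R).
    by apply: integrableS (@integrableT_gauss R) => //; exact: measurable_itv.
  have [dI dE] := @continuous_FTC1 R (@gauss_fun R) -oo%O x (x + 1) x1 ix (ltNyr x)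
    (@continuous_gauss_fun R x).
  by apply: DeriveDef; [exact: dI|rewrite -derive1E].
pose F x := I x - I 0.
have dF x : is_derive x 1 F (gauss_fun x).
  by have := is_deriveB (dI x) (is_derive_cst (I 0) x 1); rewrite subr0.
have Fnd : {homo F : x y / x <= y}.
  move=> x y xy; rewrite -subr_ge0.
  have [z _ ->] := @is_derive_mvt R F (@gauss_fun R) x y xy (fun z _ => dF z).
  by rewrite mulr_ge0 ?gauss_fun_ge0 ?subr_ge0.
have oddF x : F (- x) = - F x.
  suff : forall x y, F x + F (- x) = F y + F (- y).
    by move=> /(_ x 0); rewrite oppr0 /F !subrr addr0 addrC => /eqP; rewrite addr_eq0 => /eqP.
  move=> y z; apply: (@is_derive_0_is_cst R (fun x => F x + F (- x))) => {y}{}z.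
  have dNF : is_derive z 1 (fun x => F (- x)) (- gauss_fun z).
    have := @is_derive1_comp R F -%R z _ _ (dF (- z)) (is_deriveNid z 1).
    by rewrite mulrN1 /gauss_fun sqrrN.
  by have := is_deriveD (dF z) dNF; rewrite subrr.
have I_ge0 x : 0 <= I x by apply: Rintegral_ge0 => t _; exact: gauss_fun_ge0.
have Fle x : F x <= Num.sqrt pi.
  apply: (@le_trans _ _ (I x)); first by rewrite gerBl.
  rewrite -lee_fin /I /Rintegral fineK; last first.
    apply: integrable_fin_num; first exact: measurable_itv.
    by apply: integrableS (@integrableT_gauss R) => //; exact: measurable_itv.
  rewrite -integralT_gauss; apply: ge0_subset_integral => //.
  - exact: (measurable_int mu (@integrableT_gauss R)).
  - by move=> t _; rewrite lee_fin gauss_fun_ge0.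
exists F; split => //.
(* Monotonicity and boundedness give a limit; its value is read off afterwards from the Gaussian
   integral over the half-line. *)
have cvF : F x @[x --> +oo] --> sup (range F).
  by apply: nondecreasing_cvgr => //; exists (Num.sqrt pi) => _ [x _ <-].
have cF : continuous F.
  by move=> x; apply: differentiable_continuous; apply/derivable1_diffP; case: (dF x).
have cg : {within `[0, +oo[, continuous (@gauss_fun R)}%classic.
  by apply: continuous_subspaceT; exact: continuous_gauss_fun.
have d0 x : 0 < x -> derivable F x 1 by case: (dF x).
have dE : {in `]0, +oo[, F^`()%classic =1 @gauss_fun R}.
  by move=> x _; rewrite derive1E; exact: derive_val.
have := @ge0_continuous_FTC2y R (@gauss_fun R) F 0 _ (fun x _ => gauss_fun_ge0 x) cg
  cvF d0 (cvg_at_right_filter (cF 0)) dE.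
rewrite integral0y_gauss {2}/F subrr sube0 => -[E].
by rewrite E.
Qed.

Definition gauss a x : R := expR (- (a * x ^+ 2 / 2)).

Lemma gaussN a x : gauss a (- x) = gauss a x.
Proof. by rewrite /gauss sqrrN. Qed.

Lemma gauss_gt0 a x : 0 < gauss a x.
Proof. exact: expR_gt0. Qed.

Lemma gauss_le1 a x : 0 < a -> gauss a x <= 1.
Proof.
by move=> a0; rewrite -expR0 ler_expR oppr_le0 divr_ge0// mulr_ge0 ?sqr_ge0// ltW.
Qed.

Lemma gauss_le a x y : 0 < a -> 0 <= x -> x <= y -> gauss a y <= gauss a x.
Proof.
move=> a0 x0 xy; rewrite ler_expR lerN2 ler_pM2r ?invr_gt0// ler_pM2l//.
by rewrite lerXn2r ?nnegrE// (le_trans x0).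
Qed.

(** A rescaled odd primitive of [exp (- x^2)]: its secants lie between values of the Gaussian
    because the Gaussian decreases on the positive half-line. The tail bound is only polynomial,
    which is enough since losses of a power of n over sqrt V are affordable. *)
Lemma exists_gauss_potential a : 0 < a -> exists G : R -> R,
  [/\ forall x, G (- x) = - G x,
      forall x y, 0 <= x -> x <= y ->
        gauss a y * (y - x) <= G y - G x <= gauss a x * (y - x),
      forall x, `|G x| <= Num.sqrt (2 * pi / a) / 2
    & forall x, 0 < x -> Num.sqrt (2 * pi / a) / 2 - 2 / (a * x) <= G x].
Proof.
move=> a0; have [F [dF oddF cvF]] := exists_gauss_primitive.
pose s := Num.sqrt (a / 2).
have s0 : 0 < s by rewrite sqrtr_gt0 divr_gt0.
have s2 : s ^+ 2 = a / 2 by rewrite sqr_sqrtr// divr_ge0// ltW.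
have sL : Num.sqrt pi / s = Num.sqrt (2 * pi / a).
  rewrite -sqrtrV ?divr_ge0 ?(ltW a0)// -sqrtrM ?pi_ge0//.
  by congr (Num.sqrt _); rewrite invf_div; field; rewrite gt_eqF.
have gE x : gauss_fun (s * x) = gauss a x.
  by rewrite /gauss_fun /gauss exprMn s2; congr expR; field.
have Fmvt x y : x <= y -> exists2 z, x <= z <= y & F y - F x = gauss_fun z * (y - x).
  move=> xy; have [z] := @is_derive_mvt R F (@gauss_fun R) x y xy (fun z _ => dF z).
  by rewrite in_itv => zxy E; exists z.
have Fnd x y : x <= y -> F x <= F y.
  move=> xy; rewrite -subr_ge0; have [z _ ->] := Fmvt _ _ xy.
  by rewrite mulr_ge0 ?gauss_fun_ge0 ?subr_ge0.
have Fub x : F x <= Num.sqrt pi / 2.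
  apply: (cvgr_to_ge cvF).
  by near=> y; apply: Fnd; near: y; apply: nbhs_pinfty_ge; rewrite num_real.
(* [F t + t^-1] does not increase for [t > 0], since [exp (- z^2) <= z^-2], while [F] tends to
   [sqrt pi / 2]. *)
have Flb x : 0 < x -> Num.sqrt pi / 2 - x^-1 <= F x.
  move=> x0; rewrite lerBlDr; apply: (cvgr_to_le cvF).
  near=> y.
  have xy : x <= y by near: y; apply: nbhs_pinfty_ge; rewrite num_real.
  have dH z : z \in `[x, y] ->
      is_derive z 1 (fun t => F t + t^-1) (gauss_fun z - z ^- 2).
    rewrite in_itv /= => /andP[xz _]; have z0 : z != 0 by rewrite gt_eqF// (lt_le_trans x0).
    have dV : is_derive z 1 (fun t : R => t^-1) (- z ^- 2).
      by have := is_deriveV z0 (is_derive_id z 1); rewrite /GRing.scale /= mulr1.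
    exact: (is_deriveD (dF z) dV).
  have [z] := @is_derive_mvt R _ (fun z => gauss_fun z - z ^- 2) x y xy dH.
  rewrite in_itv /= => /andP[xz zy] E.
  have z0 : 0 < z := lt_le_trans x0 xz.
  have gz : gauss_fun z <= z ^- 2.
    rewrite /gauss_fun expRN lef_pV2 ?posrE ?expR_gt0 ?exprn_gt0//.
    by apply: le_trans (expR_ge1Dx _); rewrite lerDr.
  have : F y + y^-1 <= F x + x^-1.
    by rewrite -subr_le0 E mulr_le0_ge0 ?subr_le0 ?subr_ge0.
  by apply: le_trans; rewrite lerDl invr_ge0 (le_trans (ltW x0)).
exists (fun x => F (s * x) / s); split.
- by move=> x; rewrite mulrN oddF mulNr.
- move=> x y x0 xy.
  have sxy : s * x <= s * y by rewrite ler_pM2l.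
  rewrite -mulrBl; have [z /andP[xz zy] ->] := Fmvt _ _ sxy.
  have -> : gauss_fun z * (s * y - s * x) / s = gauss a (z / s) * (y - x).
    by rewrite -gE mulrCA divff ?gt_eqF// mulr1; field; rewrite gt_eqF.
  have xzs : x <= z / s by rewrite ler_pdivlMr// mulrC.
  have zsy : z / s <= y by rewrite ler_pdivrMr// mulrC.
  by rewrite !ler_wpM2r ?subr_ge0// gauss_le// (le_trans x0).
- move=> x; rewrite normrM [X in _ * X]gtr0_norm ?invr_gt0// -sL.
  rewrite mulrAC ler_pM2r ?invr_gt0// ler_norml Fub andbT.
  by rewrite lerNl -oddF Fub.
- move=> x x0; rewrite -sL ler_pdivlMr// mulrBl.
  have -> : Num.sqrt pi / s / 2 * s = Num.sqrt pi / 2 by field; rewrite gt_eqF.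
  have -> : 2 / (a * x) * s = (s * x)^-1.
    have -> : a = 2 * s ^+ 2 by rewrite s2; field.
    by field; rewrite !gt_eqF.
  by apply: Flb; rewrite mulr_gt0.
Unshelve. all: by end_near.
Qed.

End gauss_primitive.

(* A telescoping potential [P] with [h * g x <= P (x + h) - P x], bounded
   independently of [c], handles all grids [c + h Z] at once. *)
Section unimodal_sums.
Variables (R : realType) (g G : R -> R) (h : R).
Hypothesis oddG : forall x, G (- x) = - G x.
Hypothesis evenG : forall x, g (- x) = g x.
Hypothesis g_bounds : forall x y, 0 <= x -> x <= y ->
  g y * (y - x) <= G y - G x <= g x * (y - x).
Hypothesis g01 : forall x, 0 <= g x <= 1.
Hypothesis h_gt0 : 0 < h.

Let stepr x : h <= x -> h * g x <= G x - G (x - h).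
Proof.
move=> hx; have h0 := h_gt0; have /andP[+ _] := @g_bounds (x - h) x (ltac:(lra)) (ltac:(lra)).
by rewrite opprB addrC subrK mulrC.
Qed.

Let stepl x : x <= - h -> h * g x <= G (x + h) - G x.
Proof.
move=> xh; have := @stepr (- x); rewrite evenG (_ : - x - h = - (x + h)); last by ring.
by rewrite !oddG => /(_ (ltac:(lra))); lra.
Qed.

Let G0 : G 0 = 0. Proof. by have := oddG 0; rewrite oppr0; lra. Qed.

Let G_homo x y : x <= y -> 0 <= G y - G x <= y - x.
Proof.
have pos u v : 0 <= u -> u <= v -> 0 <= G v - G u <= v - u.
  move=> u0 uv; have /andP[lo up] := g_bounds u0 uv.
  have /andP[gu0 gu1] := g01 u; have /andP[gv0 _] := g01 v.
  apply/andP; split; first by apply: le_trans lo; rewrite mulr_ge0 ?subr_ge0.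
  by apply: le_trans up _; rewrite ler_piMl ?subr_ge0.
move=> xy; have [x0|x0] := leP 0 x; first exact: pos.
have [y0|y0] := leP 0 y.
  have := pos _ _ (lexx 0) y0; have := pos 0 (- x) (lexx 0) (ltac:(lra)).
  by rewrite oddG G0; lra.
by have := pos (- y) (- x) (ltac:(lra)) (ltac:(lra)); rewrite !oddG; lra.
Qed.

Lemma unimodal_sum_le (L c : R) M : (forall x, `|G x| <= L / 2) ->
  \sum_(j < M) h * g (j%:R * h + c) <= L + 2 * h.
Proof.
(* For [x] in []- h, h]] an adjacent increment of [G] need not dominate [h * g x]. A grid of mesh
   [h] has at most two points there, and [P] pays a full [h] for each; hence the excess [2 * h]. *)
move=> GL; have h0 := h_gt0; pose P x := if x <= 0 then G x else
  if x <= h then G (x - h) + h else G (x - h) + 2 * h.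
have PP x : h * g x <= P (x + h) - P x.
  have hg1 : h * g x <= h by rewrite ler_piMr// ?(ltW h_gt0)//; case/andP: (g01 x).
  rewrite /P; have [x0|x0] := leP x 0.
    have [xh|xh] := leP (x + h) 0; first by apply: stepl; lra.
    by have [xh'|] := leP (x + h) h; [rewrite addrK; lra|lra].
  have -> : (x + h <= 0) = false by apply/negbTE; rewrite -ltNge; lra.
  have -> : (x + h <= h) = false by apply/negbTE; rewrite -ltNge; lra.
  rewrite addrK; have [xh|xh] := leP x h; last by have := stepr (ltW xh); lra.
  by have /andP[] := @G_homo (x - h) x (ltac:(lra)); lra.
have PL x : - (L / 2) <= P x <= L / 2 + 2 * h.
  have /ler_normlP[] := GL x; have /ler_normlP[] := GL (x - h).
  by rewrite /P; case: ifP => _; [lra|case: ifP => _; lra].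
apply: (@le_trans _ _ (\sum_(0 <= j < M) (P (j.+1%:R * h + c) - P (j%:R * h + c)))).
  rewrite big_mkord; apply: ler_sum => j _.
  by apply: le_trans (PP _) _; rewrite -natr1 mulrDl mul1r addrAC.
rewrite (telescope_sumr (fun j : nat => P (j%:R * h + c)))//.
by have := PL (M%:R * h + c); have := PL (0%:R * h + c); lra.
Qed.

Lemma unimodal_sum_ge (r c : R) M : 0 < r -> c <= - r -> r <= M%:R * h + c ->
  2 * G r - h <= \sum_(j < M | `|j%:R * h + c| <= r) h * g (j%:R * h + c).
Proof.
(* [k] is [g] truncated to [[- r, r]], and [K] is its primitive: clamping the argument freezes [G]
   outside the window. *)
move=> r0 cr Mr; have h0 := h_gt0; pose K x := G (Num.max (- r) (Num.min x r)).
pose k x := if `|x| <= r then g x else 0.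
have Kl x : x <= - r -> K x = - G r.
  move=> xr; have xr' : x <= r by lra.
  by rewrite /K (min_idPl xr') max_l ?oddG.
have Kr x : r <= x -> K x = G r.
  by move=> xr; rewrite /K min_r ?max_r//; lra.
have Km x : - r <= x <= r -> K x = G x.
  by move=> /andP[xr rx]; rewrite /K min_l ?max_r//.
have oddK x : K (- x) = - K x.
  have [xr|xr] := leP x (- r); first by rewrite (Kl x)// (Kr (- x)) ?opprK//; lra.
  have [rx|rx] := leP r x; first by rewrite (Kr x)// (Kl (- x))//; lra.
  by rewrite !Km ?oddG//; lra.
have evenk x : k (- x) = k x by rewrite /k normrN evenG.
have K_step x : 0 <= x -> K (x + h) - K x <= h * k x.
  move=> x0; rewrite /k ger0_norm//; have [xr|xr] := leP x r; last first.
    by rewrite !Kr ?mulr0//; lra.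
  have [xhr|xhr] := leP r (x + h).
    rewrite Kr// (Km x); last lra.
    have /andP[_ up] := g_bounds x0 xr; apply: le_trans up _; rewrite mulrC ler_wpM2r//.
      by case/andP: (g01 x).
    by lra.
  rewrite !Km; try lra.
  have /andP[_] := @g_bounds x (x + h) x0 (ltac:(lra)).
  by rewrite [x + h]addrC addrK mulrC.
have K_homo x y : x <= y -> 0 <= K y - K x <= y - x.
  move=> xy; rewrite /K; set a := Num.max _ (Num.min x _); set b := Num.max _ _.
  have [ab abxy] : a <= b /\ b - a <= y - x.
    rewrite /a /b; case: (leP x r) => xr; case: (leP y r) => yr.
    - by case: (leP (- r) x) => ?; case: (leP (- r) y) => ?; split; lra.
    - by case: (leP (- r) x) => ?; case: (leP (- r) r) => ?; split; lra.
    - by exfalso; lra.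
    - by rewrite subrr; split; lra.
  by have := G_homo ab; lra.
(* Left of the mode the increment of [K] just before [x] lies below [h * k x], right of it the one
   just after. Switching between the two costs a single [h]. *)
pose P x := if x <= h then K (x - h) else K x - h.
have PP x : P (x + h) - P x <= h * k x.
  rewrite /P; have [x0|x0] := leP x 0.
    have -> : x + h <= h by lra.
    have -> : x <= h by lra.
    rewrite addrK; have := @K_step (- x); rewrite evenk (_ : - x + h = - (x - h)) ?oddK; last by ring.
    by move=> /(_ (ltac:(lra))); lra.
  have -> : (x + h <= h) = false by apply/negbTE; rewrite -ltNge; lra.
  have := K_step x (ltW x0); have := @K_homo (x - h) x (ltac:(lra)).
  by case: (leP x h) => _; lra.
apply: (@le_trans _ _ (\sum_(0 <= j < M) (P (j.+1%:R * h + c) - P (j%:R * h + c)))).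
  rewrite (telescope_sumr (fun j : nat => P (j%:R * h + c)))// mul0r add0r.
  have -> : P c = - G r by rewrite /P (_ : c <= h) ?Kl//; lra.
  have := @K_homo (M%:R * h + c - h) (M%:R * h + c) (ltac:(lra)).
  by rewrite /P; case: ifP => _; rewrite (Kr _ Mr); lra.
rewrite big_mkord [leRHS]big_mkcond; apply: ler_sum => j _.
apply: le_trans (_ : _ <= h * k (j%:R * h + c)) _.
  by apply: le_trans (PP _); rewrite -natr1 mulrDl mul1r addrAC.
by rewrite /k; case: ifP => _; rewrite ?mulr0.
Qed.

End unimodal_sums.

Section gauss_sums.
Variable R : realType.
Implicit Types a h c r : R.

Lemma gauss01 a (x : R) : 0 < a -> 0 <= gauss a x <= 1.
Proof. by move=> a0; rewrite ltW ?gauss_gt0//= gauss_le1. Qed.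

Lemma gauss_sum_le a h c M : 0 < a -> 0 < h ->
  \sum_(j < M) h * gauss a (j%:R * h + c) <= Num.sqrt (2 * pi / a) + 2 * h.
Proof.
move=> a0 h0; have [G [oddG bG GL _]] := exists_gauss_potential a0.
exact (unimodal_sum_le oddG (gaussN a) bG (fun x => gauss01 x a0) h0 c M GL).
Qed.

Lemma gauss_sum_ge a h c r M : 0 < a -> 0 < h -> 0 < r -> c <= - r ->
  r <= M%:R * h + c ->
  Num.sqrt (2 * pi / a) - 4 / (a * r) - h <=
    \sum_(j < M | `|j%:R * h + c| <= r) h * gauss a (j%:R * h + c).
Proof.
move=> a0 h0 r0 cr Mr; have [G [oddG bG _ GL]] := exists_gauss_potential a0.
apply: le_trans (unimodal_sum_ge oddG (gaussN a) bG (fun x => gauss01 x a0) h0 r0 cr Mr).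
by have := GL _ r0; lra.
Qed.

End gauss_sums.

(** * Iterated sums with triangular dependence *)

Section chain_sums.
Variables (R : realType) (T : finType).
Implicit Types (m : nat) (y : T -> R) (w : nat -> R -> T -> R).

Definition ffun_rcons m (f : {ffun 'I_m -> T}) (t : T) : {ffun 'I_m.+1 -> T} :=
  [ffun i => oapp f t (unlift ord_max i)].

Lemma ffun_rcons_max m (f : {ffun 'I_m -> T}) t : ffun_rcons f t ord_max = t.
Proof. by rewrite ffunE unlift_none. Qed.

Lemma ffun_rcons_widen m (f : {ffun 'I_m -> T}) t (i : 'I_m) :
  ffun_rcons f t (widen_ord (leqnSn m) i) = f i.
Proof.
have -> : widen_ord (leqnSn m) i = lift ord_max i.
  by apply: val_inj; rewrite /= /bump leqNgt ltn_ord.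
by rewrite ffunE liftK.
Qed.

Lemma sum_ffun_rcons m (F : {ffun 'I_m.+1 -> T} -> R) :
  \sum_f F f = \sum_f \sum_t F (ffun_rcons f t).
Proof.
rewrite pair_big /= (reindex (fun p : {ffun 'I_m -> T} * T => ffun_rcons p.1 p.2)) //=.
exists (fun f => ([ffun i => f (widen_ord (leqnSn m) i)], f ord_max)) => [[f t] _|f _].
  by congr pair; [apply/ffunP => i; rewrite ffunE ffun_rcons_widen|exact: ffun_rcons_max].
apply/ffunP => i; rewrite ffunE; case: unliftP => [j ->|->] //=.
by rewrite ffunE; congr (f _); apply: val_inj; rewrite /= /bump leqNgt ltn_ord.
Qed.

Definition partial_sum m y (f : {ffun 'I_m -> T}) (i : nat) : R :=
  \sum_(j < m | (j < i)%N) y (f j).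

(** The shape of the Gaussian once its squares are completed: each variable is centred at a multiple
    of the sum of the earlier ones, so that sum is all that factor [i] needs to know about them. *)
Definition chain m y w (f : {ffun 'I_m -> T}) : R :=
  \prod_(i < m) w i (partial_sum y f i) (f i).

Lemma partial_sum_rcons m y (f : {ffun 'I_m -> T}) t i : (i <= m)%N ->
  partial_sum y (ffun_rcons f t) i = partial_sum y f i.
Proof.
move=> im; rewrite /partial_sum big_mkcond big_ord_recr /= ltnNge im addr0 [RHS]big_mkcond.
by apply: eq_bigr => j _; rewrite ffun_rcons_widen.
Qed.

Lemma chain_rcons m y w (f : {ffun 'I_m -> T}) t :
  chain y w (ffun_rcons f t) = chain y w f * w m (partial_sum y f m) t.
Proof.
rewrite /chain big_ord_recr /= ffun_rcons_max partial_sum_rcons//; congr (_ * _).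
by apply: eq_bigr => i _; rewrite ffun_rcons_widen partial_sum_rcons// ltnW.
Qed.

Lemma chain_ge0 m y w (f : {ffun 'I_m -> T}) :
  (forall i s t, 0 <= w i s t) -> 0 <= chain y w f.
Proof. by move=> w0; apply: prodr_ge0. Qed.

(** The last variable occurs only in the last factor, so it can be summed out first, at a cost of
    [U m] that does not depend on the other variables. *)
Lemma chain_sum_le m y w (U : nat -> R) :
  (forall i s t, 0 <= w i s t) ->
  (forall i s, (i < m)%N -> \sum_t w i s t <= U i) ->
  \sum_(f : {ffun 'I_m -> T}) chain y w f <= \prod_(i < m) U i.
Proof.
move=> w0; elim: m => [|m IH] wU.
  rewrite big_ord0 (eq_bigr (fun=> 1)) => [|f _]; last by rewrite /chain big_ord0.
  by rewrite sumr_const card_ffun card_ord expn0.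
rewrite sum_ffun_rcons big_ord_recr /=.
apply: (@le_trans _ _ (\sum_f chain y w f * U m)).
  apply: ler_sum => f _; under eq_bigr do rewrite chain_rcons.
  by rewrite -mulr_sumr ler_wpM2l ?chain_ge0 ?wU.
rewrite -mulr_suml ler_wpM2r ?IH// => [|i s im]; last by rewrite wU// ltnW.
by apply: le_trans (wU m 0 (ltnSn m)); rewrite sumr_ge0.
Qed.

(** Again the last variable is summed out first. A uniform lower bound cannot hold for arbitrary
    centres, but the restriction to [P] bounds the earlier values, so [L i] is only required for
    partial sums that can occur. *)
Lemma chain_sum_ge m y w (P : nat -> pred T) (W L : nat -> R) :
  (forall i s t, 0 <= w i s t) -> (forall i, (i < m)%N -> 0 <= L i) ->
  (forall i t, P i t -> `|y t| <= W i) ->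
  (forall i s, (i < m)%N -> `|s| <= \sum_(j < i) W j ->
    L i <= \sum_(t | P i t) w i s t) ->
  \prod_(i < m) L i <=
    \sum_(f : {ffun 'I_m -> T} | [forall i : 'I_m, P i (f i)]) chain y w f.
Proof.
move=> w0 + PW; elim: m => [|m IH] L0 wL.
  rewrite big_ord0 (eq_bigr (fun=> 1)) => [|f _]; last by rewrite /chain big_ord0.
  rewrite (eq_bigl xpredT) => [|f]; last by apply/forallP => -[].
  by rewrite sumr_const card_ffun card_ord expn0.
rewrite [leRHS]big_mkcond sum_ffun_rcons big_ord_recr /=.
have PE (f : {ffun 'I_m -> T}) t : [forall i : 'I_m.+1, P i (ffun_rcons f t i)] =
    [forall i : 'I_m, P i (f i)] && P m t.
  apply/forallP/andP => [Pf|[/forallP Pf Pt] i].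
    split; last by have := Pf ord_max; rewrite ffun_rcons_max.
    by apply/forallP => i; have := Pf (widen_ord (leqnSn m) i); rewrite ffun_rcons_widen.
  rewrite ffunE; case: unliftP => [j ->|->] //=.
  by rewrite /bump leqNgt ltn_ord; exact: Pf.
apply: (@le_trans _ _ (\sum_(f : {ffun 'I_m -> T} | [forall i : 'I_m, P i (f i)])
    chain y w f * L m)).
  rewrite -mulr_suml ler_wpM2r ?L0// IH// => [i im|i s im]; first by rewrite L0// ltnW.
  by apply: wL; rewrite ltnW.
rewrite big_mkcond; apply: ler_sum => f _; case: ifP => Pf; last first.
  by apply: sumr_ge0 => t _; rewrite PE Pf.
under eq_bigr do rewrite PE Pf chain_rcons /=.
rewrite -big_mkcond -mulr_sumr ler_wpM2l ?chain_ge0// wL//.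
apply: le_trans (ler_norm_sum _ _ _) _.
rewrite (eq_bigl xpredT) => [|j]; last exact: ltn_ord.
by apply: ler_sum => j _; apply/PW; move/forallP: Pf; apply.
Qed.

End chain_sums.

Section gauss_chains.
Variable R : realType.
Implicit Types (a kappa W : nat -> R) (h r : R).

Definition gridpt (A : nat) h (t : 'I_A.*2.+1) : R := (t%:R - A%:R) * h.

Definition gauss_weight (T : finType) (y : T -> R) a kappa h (i : nat) (s : R) (t : T) : R :=
  h * gauss (a i) (y t - kappa i * s).

Lemma gauss_chain_sum_le m A a kappa h : 0 < h -> (forall i, 0 < a i) ->
  \sum_(f : {ffun 'I_m -> 'I_A.*2.+1})
      chain (gridpt h) (gauss_weight (gridpt h) a kappa h) f <=
    \prod_(i < m) (Num.sqrt (2 * pi / a i) + 2 * h).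
Proof.
move=> h0 a0; apply: (@chain_sum_le R _ m _ _ (fun i => Num.sqrt (2 * pi / a i) + 2 * h)).
  by move=> i s t; rewrite mulr_ge0 ?ltW ?gauss_gt0.
move=> i s _; apply: le_trans (gauss_sum_le (- (A%:R * h) - kappa i * s) _ (a0 i) h0).
by rewrite le_eqVlt; apply/orP; left; apply/eqP; apply: eq_bigr => t _; congr (_ * gauss _ _); rewrite /gridpt; ring.
Qed.

(** The peak of variable [i] sits at [kappa i * s] and moves with the earlier variables. The
    condition on [W] keeps a window of half-width [r] around the peak inside box [i], and the next
    one keeps the boxes inside the grid. *)
Lemma gauss_chain_sum_ge m A a kappa W h r : 0 < h -> 0 < r -> (forall i, 0 < a i) ->
  (forall i, (i < m)%N -> r + `|kappa i| * (\sum_(j < i) W j) <= W i) ->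
  (forall i, (i < m)%N -> W i <= A%:R * h) ->
  (forall i, (i < m)%N -> 4 / (a i * r) + h <= Num.sqrt (2 * pi / a i)) ->
  \prod_(i < m) (Num.sqrt (2 * pi / a i) - 4 / (a i * r) - h) <=
  \sum_(f : {ffun 'I_m -> 'I_A.*2.+1} | [forall i : 'I_m, `|gridpt h (f i)| <= W i])
      chain (gridpt h) (gauss_weight (gridpt h) a kappa h) f.
Proof.
move=> h0 r0 a0 rW WA aL.
apply: (@chain_sum_ge R _ m _ _ (fun i t => `|gridpt h t| <= W i) W
  (fun i => Num.sqrt (2 * pi / a i) - 4 / (a i * r) - h)) => //.
- by move=> i s t; rewrite mulr_ge0 ?ltW ?gauss_gt0.
- by move=> i im; have := aL i im; lra.
move=> i s im sW; pose c := - (A%:R * h) - kappa i * s.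
have ksW : `|kappa i * s| <= `|kappa i| * (\sum_(j < i) W j) by rewrite normrM ler_wpM2l.
have rWi := rW i im; have WAi := WA i im.
have ksr : `|kappa i * s| <= W i - r by lra.
have /andP[ks1 ks2] : - (W i - r) <= kappa i * s <= W i - r by rewrite -ler_norml.
apply: le_trans (@gauss_sum_ge R (a i) h c r A.*2.+1 (a0 i) h0 r0 _ _) _.
- by rewrite /c; lra.
- by rewrite /c -addnn -natr1 natrD; lra.
have ptE (t : 'I_A.*2.+1) : t%:R * h + c = gridpt h t - kappa i * s.
  by rewrite /c /gridpt; ring.
rewrite big_mkcond [leRHS]big_mkcond; apply: ler_sum => t _.
rewrite ptE; case: ifP => tr; last first.
  by case: ifP => _ //; rewrite mulr_ge0 ?ltW ?gauss_gt0.
suff -> : `|gridpt h t| <= W i by [].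
by rewrite -(subrK (kappa i * s) (gridpt h t)); apply: le_trans (ler_normD _ _) _; lra.
Qed.

End gauss_chains.

(** * Edge counts and the quadratic form of the phases *)

Section counting.
Variable T : finType.
Implicit Types (i j : T) (B e : {set T}).

Lemma card_draws_with k i B : i \notin B ->
  #|[set e : {set T} | [&& #|e| == k.+1, i \in e & e \subset i |: B]]| = 'C(#|B|, k).
Proof.
move=> iB; pose D := [set A : {set T} | A \subset B & #|A| == k].
have injD : {in D &, injective (fun e => i |: e)}.
  move=> e1 e2; rewrite !inE => /andP[/fintype.subsetP e1B _] /andP[/fintype.subsetP e2B _] E.
  rewrite -(@finset.setU1K _ i e1) 1?E ?finset.setU1K//; apply/negP.
    by move/e2B; apply/negP.
  by move/e1B; apply/negP.
rewrite -cards_draws -(card_in_imset injD).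
apply: eq_card => e; rewrite !inE; apply/idP/imsetP => [/and3P[ek ie eB]|[f]].
  exists (e :\ i); last by rewrite finset.setD1K.
  rewrite inE.
  apply/andP; split.
    apply/fintype.subsetP => x; rewrite !inE => /andP[xi xe].
    by have := fintype.subsetP eB x xe; rewrite !inE (negbTE xi).
  by move: ek; rewrite (cardsD1 i e) ie add1n eqSS.
rewrite inE => /andP[fB fk] ->; 
have fi : i \notin f by apply/negP => /(fintype.subsetP fB); apply/negP.
by rewrite cardsU1 fi add1n eqSS fk finset.setU11 finset.setUS.
Qed.

Lemma card_sets_with k i :
  #|[set e : {set T} | (#|e| == k.+1) && (i \in e)]| = 'C(#|T|.-1, k).
Proof.
rewrite -(cardsC1 i) -(@card_draws_with k i); last by rewrite !inE eqxx.
by apply: eq_card => e; rewrite !inE finset.setUCr finset.subsetT andbT.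
Qed.

Lemma card_sets_with_without k i j : i != j ->
  #|[set e : {set T} | [&& #|e| == k.+1, i \in e & j \notin e]]| = 'C(#|T|.-2, k).
Proof.
move=> ij; have -> : #|T|.-2 = #|~: [set i; j]|.
  by rewrite cardsCs finset.setCK cards2 ij -subn2.
rewrite -(@card_draws_with k i); last by rewrite !inE eqxx.
apply: eq_card => e; rewrite !inE; congr [&& _, _ & _].
apply/idP/fintype.subsetP => [je x xe|H].
  rewrite !inE; case: (x =P i) => //= _; apply/negP => /eqP xj.
  by rewrite -xj xe in je.
by apply/negP => /H; rewrite !inE eqxx orbT (eq_sym j) (negbTE ij).
Qed.

Lemma card_sets k : #|[set e : {set T} | #|e| == k]| = 'C(#|T|, k).
Proof.
by rewrite -cardsT -cards_draws; apply: eq_card => e; rewrite !inE finset.subsetT.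
Qed.

End counting.

Section phases.
Variables (R : realType) (n : nat).
Implicit Types (theta : 'I_n.+1 -> R) (e : {set 'I_n.+1}) (i : 'I_n.+1).

(* The last vertex enters every phase: its variable is dual to the number of
   edges instead of its degree, which the number of edges and the other
   degrees determine. The integrand then has a single peak. *)
Definition phase theta e : R := \sum_(i in ord_max |: e) theta i.

Lemma phaseE theta e :
  phase theta e = theta ord_max + \sum_(i < n) theta (widen_ord (leqnSn n) i) *+
    (widen_ord (leqnSn n) i \in e).
Proof.
rewrite /phase big_mkcond big_ord_recr /= !inE eqxx addrC; congr (_ + _).
apply: eq_bigr => i _; rewrite !inE mulrb.
suff -> : widen_ord (leqnSn n) i == ord_max = false by [].
by apply/eqP => /(congr1 val) /= /eqP; rewrite ltn_eqF.
Qed.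

Lemma sum_edges_with k i :
  \sum_(e : {set 'I_n.+1} | #|e| == k.+1) (i \in e)%:R = 'C(n, k)%:R :> R.
Proof.
rewrite -natr_sum -big_mkcondr sum1_card -[n in RHS]/(n.+1.-1) -[in RHS](card_ord n.+1).
by rewrite -(card_sets_with k i) cardsE.
Qed.

(** Edges through [i] minus those that avoid [j]. Keeping the difference avoids a binomial with the
    truncated [k.-1]. *)
Lemma sum_edges_with_both k i j : i != j ->
  \sum_(e : {set 'I_n.+1} | #|e| == k.+1) (i \in e)%:R * (j \in e)%:R =
    'C(n, k)%:R - 'C(n.-1, k)%:R :> R.
Proof.
move=> ij; rewrite -(sum_edges_with k i).
have -> : 'C(n.-1, k)%:R =
    \sum_(e : {set 'I_n.+1} | #|e| == k.+1) (i \in e)%:R * (j \notin e)%:R :> R.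
  under eq_bigr do rewrite -natrM mulnb.
  rewrite -natr_sum -big_mkcondr sum1_card -[n.-1]/(n.+1.-2) -[in LHS](card_ord n.+1).
  by rewrite -(card_sets_with_without k ij) cardsE.
by rewrite -sumrB; apply: eq_bigr => e _; do 2 case: (_ \in e); rewrite /=; ring.
Qed.

End phases.

(** With [S] the sum of the earlier terms, passing from [n] to [n + 1] adds
    [t^2 + S^2/(n+1) - (S+t)^2/(n+2)], which is [(n+1)/(n+2)] times the square of [t - S/(n+1)]. *)
Lemma sum_sqr_diag (R : realType) (t : nat -> R) n :
  \sum_(l < n) t l ^+ 2 - (\sum_(l < n) t l) ^+ 2 / n.+1%:R =
  \sum_(l < n) (l.+1%:R / l.+2%:R) * (t l - l.+1%:R^-1 * \sum_(j < l) t j) ^+ 2.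
Proof.
elim: n => [|n IH]; first by rewrite !big_ord0 expr0n /= mul0r subr0.
rewrite !big_ord_recr /= -IH.
have n0 : n%:R >= 0 :> R by [].
by rewrite -!natr1; field; apply/andP; split; rewrite gt_eqF//; lra.
Qed.

Section phase_form.
Variables (R : realType) (n k : nat).
Hypotheses (n_gt0 : (0 < n)%N) (k_lt : (k < n)%N).
Implicit Types (theta : 'I_n.+1 -> R) (e : {set 'I_n.+1}).

Definition diag_coef (i : nat) : R :=
  if (i < n)%N then 'C(n.-1, k)%:R * (i.+1%:R / i.+2%:R) else 'C(n.+1, k.+1)%:R.

Definition diag_shift (i : nat) : R :=
  if (i < n)%N then i.+1%:R^-1 else - (k.+1%:R / n.+1%:R).

Lemma sum_sqr_phase theta (t : 'I_n -> R) :
  (forall i, theta (widen_ord (leqnSn n) i) = t i) ->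
  \sum_(e : {set 'I_n.+1} | #|e| == k.+1) phase theta e ^+ 2 =
  'C(n.+1, k.+1)%:R * theta ord_max ^+ 2
  + 2 * 'C(n, k)%:R * theta ord_max * (\sum_i t i)
  + 'C(n.-1, k)%:R * (\sum_i t i ^+ 2)
  + ('C(n, k)%:R - 'C(n.-1, k)%:R) * (\sum_i t i) ^+ 2.
Proof.
move=> tE; set s := theta ord_max.
pose z e := \sum_(i < n) t i * (widen_ord (leqnSn n) i \in e)%:R.
have yE e : phase theta e = s + z e.
  by rewrite phaseE; congr (_ + _); apply: eq_bigr => i _; rewrite tE mulr_natr.
under eq_bigr => e _ do rewrite yE sqrrD -mulr_natl.
rewrite !big_split /= sumr_const -[(s ^+ 2) *+ _]mulr_natl.
have -> : #|[pred e : {set 'I_n.+1} | #|e| == k.+1]| = 'C(n.+1, k.+1).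
  by rewrite -[in RHS](card_ord n.+1) -(card_sets _ k.+1) cardsE.
rewrite -!addrA; congr (_ + _).
have -> : \sum_(e : {set 'I_n.+1} | #|e| == k.+1) 2%:R * (s * z e) =
    2 * 'C(n, k)%:R * s * \sum_i t i.
  rewrite -!mulr_sumr exchange_big /=.
  under eq_bigr => i _ do rewrite -mulr_sumr sum_edges_with.
  by rewrite -mulr_suml; ring.
congr (_ + _).
have -> : \sum_(e : {set 'I_n.+1} | #|e| == k.+1) z e ^+ 2 = \sum_i \sum_j
    t i * t j * ('C(n, k)%:R - 'C(n.-1, k)%:R + (i == j)%:R * 'C(n.-1, k)%:R).
  under eq_bigr => e _ do rewrite expr2 {1}/z mulr_suml.
  rewrite exchange_big; apply: eq_bigr => i _ /=.
  under eq_bigr => e _ do rewrite mulr_sumr.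
  rewrite exchange_big; apply: eq_bigr => j _ /=.
  under eq_bigr => e _ do rewrite mulrACA.
  rewrite -mulr_sumr; congr (_ * _); have [->|ij] := eqVneq i j.
    rewrite mul1r subrK -(sum_edges_with _ _ (widen_ord (leqnSn n) j)).
    by apply: eq_bigr => e _; case: (_ \in _); rewrite ?mulr1 ?mulr0.
  by rewrite mul0r addr0 sum_edges_with_both.
rewrite mulr_sumr expr2 mulr_suml mulr_sumr -big_split /=; apply: eq_bigr => i _.
have -> : 'C(n.-1, k)%:R * t i ^+ 2 =
    \sum_j t i * t j * ((i == j)%:R * 'C(n.-1, k)%:R).
  rewrite (bigD1 i) //= eqxx mul1r big1 ?addr0 => [|j]; first by rewrite expr2 mulrC.
  by rewrite eq_sym => /negbTE ->; rewrite mul0r mulr0.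
by rewrite !mulr_sumr -big_split /=; apply: eq_bigr => j _; ring.
Qed.

(** Completing the square in the last variable leaves [C(n-1,k)] times [S2 - S1^2 / (n+1)] in the
    others, thanks to the ratios of the three binomials; this is exactly the form that
    [sum_sqr_diag] makes triangular. *)
Lemma phase_form_diag theta :
  \sum_(e : {set 'I_n.+1} | #|e| == k.+1) phase theta e ^+ 2 =
  \sum_(i < n.+1) diag_coef i *
    (theta i - diag_shift i * \sum_(j < n.+1 | (j < i)%N) theta j) ^+ 2.
Proof.
pose t l := theta (inord l).
have tE (i : 'I_n) : theta (widen_ord (leqnSn n) i) = t i.
  by congr theta; apply: val_inj; rewrite /= inordK// ltnS ltnW.
have psum (i : nat) : (i <= n)%N ->
    \sum_(j < n.+1 | (j < i)%N) theta j = \sum_(j < i) t j.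
  move=> i_n; rewrite (big_ord_widen_cond n.+1 xpredT t); last by rewrite leqW.
  by apply: eq_bigr => j _; rewrite /t inord_val.
rewrite (@sum_sqr_phase theta (fun i => t i) tE); set s := theta ord_max.
rewrite big_ord_recr /= /diag_coef /diag_shift ltnn psum// -/s.
under [in RHS]eq_bigr => i _ do rewrite ltn_ord psum 1?ltnW// tE -mulrA.
rewrite -mulr_sumr -sum_sqr_diag.
set S1 := \sum_(i < n) t i; set S2 := \sum_(i < n) _.
have n0 : n.+1%:R != 0 :> R by rewrite pnatr_eq0.
have k0 : k.+1%:R != 0 :> R by rewrite pnatr_eq0.
have nn0 : n%:R != 0 :> R by rewrite pnatr_eq0 -lt0n.
have E1 : 'C(n.+1, k.+1)%:R = n.+1%:R * 'C(n, k)%:R / k.+1%:R :> R.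
  by rewrite -natrM (mul_bin_diag n.+1 k) natrM mulrAC divff// mul1r.
have E2 : 'C(n.-1, k)%:R = (n%:R - k%:R) * 'C(n, k)%:R / n%:R :> R.
  by rewrite -natrB ?(ltnW k_lt)// -natrM -mul_bin_down natrM mulrAC divff// mul1r.
rewrite E1 E2 -!natr1 in n0 k0 *; field.
by rewrite n0 nn0 k0.
Qed.

End phase_form.

(** * Bounding every variable by the energy *)

Definition phase_energy (R : realType) (n : nat) (u : R -> R) (k : nat)
    (theta : 'I_n.+1 -> R) : R :=
  \sum_(e : {set 'I_n.+1} | #|e| == k.+1) u (phase theta e) ^+ 2.

Lemma phase_energy_ge0 (R : realType) (n : nat) (u : R -> R) (k : nat)
  (theta : 'I_n.+1 -> R) : 0 <= phase_energy u k theta.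
Proof. by apply: sumr_ge0 => e _; rewrite sqr_ge0. Qed.

(* For [u = `|_|] and [u x = `|sin (x / 2)|], the energy controls every variable:
   swapping a vertex for the last one changes the phase of an edge by exactly the
   variable of that vertex. *)
Section phase_control.
Variables (R : realType) (n k : nat) (u : R -> R).
Hypotheses (n_gt0 : (0 < n)%N) (k_lt : (k < n)%N).
Hypotheses (u0 : u 0 = 0) (u_ge0 : forall x, 0 <= u x) (evenu : forall x, u (- x) = u x).
Hypothesis (u_subadd : forall x y, u (x + y) <= u x + u y).
Variable theta : 'I_n.+1 -> R.
Implicit Types (e : {set 'I_n.+1}).

Local Notation G := (phase_energy u k theta).

(** The quotient of the two binomials is [(n+1) n / ((k+1) (n-k))], and [n <= (k+1) (n-k)] when
    [k < n]. *)
Lemma binom_edges_le_pairs : ('C(n.+1, k.+1) <= n.+1 * 'C(n.-1, k))%N.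
Proof.
rewrite -(leq_pmul2l (ltn0Sn k)) -mul_bin_diag mulnCA leq_pmul2l//=.
rewrite -(leq_pmul2l n_gt0) [leqRHS]mulnCA mul_bin_down mulnA leq_mul2r.
apply/orP; right; rewrite mulSn mulnC mulnBl.
by rewrite -(@leq_add2r (k * k)) -addnA subnK ?leq_mul2r ?(ltnW k_lt) ?orbT//; nia.
Qed.

Lemma vertex_control (i : 'I_n.+1) : i != ord_max ->
  u (theta i) ^+ 2 * 'C(n.-1, k)%:R <= 4 * G.
Proof.
move=> il; pose D := [set e : {set 'I_n.+1} | [&& #|e| == k.+1, i \in e & ord_max \notin e]].
pose sw e := ord_max |: (e :\ i).
have DE : 'C(n.-1, k)%:R = \sum_(e in D) 1 :> R.
  by rewrite sumr_const -[n.-1]/(n.+1.-2) -[in LHS](card_ord n.+1) -(card_sets_with_without k il).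
have subG (A : {set {set 'I_n.+1}}) : (forall e, e \in A -> #|e| = k.+1) ->
    \sum_(e in A) u (phase theta e) ^+ 2 <= G.
  move=> Ak; rewrite [leRHS]big_mkcond [leLHS]big_mkcond; apply: ler_sum => e _.
  case: ifP => [/Ak ->|_]; first by rewrite eqxx.
  by case: ifP => _; rewrite ?sqr_ge0.
have sw_card e : e \in D -> #|sw e| = k.+1.
  rewrite inE => /and3P[/eqP ek ie le].
  rewrite /sw cardsU1 !inE (negbTE le) andbF add1n; congr _.+1.
  by move: ek; rewrite (cardsD1 i e) ie add1n => -[].
have sw_inj : {in D &, injective sw}.
  move=> e1 e2; rewrite !inE => /and3P[_ i1 l1] /and3P[_ i2 l2] E.
  have nl (e : {set 'I_n.+1}) : ord_max \notin e -> ord_max \notin e :\ i.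
    by rewrite !inE => /negbTE ->; rewrite andbF.
  rewrite -(finset.setD1K i1) -(finset.setD1K i2).
  by rewrite -(finset.setU1K (nl _ l1)) -(finset.setU1K (nl _ l2)) -/(sw e1) -/(sw e2) E.
have swE e : e \in D -> theta i = phase theta e - phase theta (sw e).
  rewrite inE => /and3P[_ ie le]; rewrite /phase (bigD1 i) /=; last by rewrite !inE ie orbT.
  rewrite [X in _ = _ + X - _](_ : _ = \sum_(j in ord_max |: sw e) theta j) ?addrK//.
  apply: eq_bigl => j; rewrite !inE; case: (j =P ord_max) => //= [->|_].
    by rewrite eq_sym il.
  by rewrite andbC.
have step e : e \in D ->
    u (theta i) ^+ 2 <= 2 * u (phase theta e) ^+ 2 + 2 * u (phase theta (sw e)) ^+ 2.
  move=> eD; have : u (theta i) <= u (phase theta e) + u (phase theta (sw e)).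
    by rewrite (swE e eD); apply: le_trans (u_subadd _ _) _; rewrite evenu.
  move: (u_ge0 (theta i)) (u_ge0 (phase theta e)) (u_ge0 (phase theta (sw e))).
  set a := u _; set b := u _; set c := u _ => a0 b0 c0 abc.
  by have := sqr_ge0 (b - c); nra.
rewrite DE mulr_sumr.
apply: (@le_trans _ _ (\sum_(e in D)
    (2 * u (phase theta e) ^+ 2 + 2 * u (phase theta (sw e)) ^+ 2))).
  by apply: ler_sum => e eD; rewrite mulr1; exact: step.
rewrite big_split /= -!mulr_sumr -(big_imset (fun e => u (phase theta e) ^+ 2) sw_inj) /=.
have H2 : \sum_(e in [set sw e | e in D]) u (phase theta e) ^+ 2 <= G.
  by apply: subG => _ /imsetP[e /sw_card eD ->].
suff : \sum_(e in D) u (phase theta e) ^+ 2 <= G by lra.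
by apply: subG => e; rewrite inE => /and3P[/eqP].
Qed.

(** Some edge has at most the average energy, and passing from it to another set changes the phase
    by at most [n] variables that [vertex_control] already bounds. The set [e] may have any size:
    the empty set yields the last variable alone. *)
Lemma phase_control e :
  u (phase theta e) ^+ 2 * 'C(n.+1, k.+1)%:R <= 4 * n.+1%:R ^+ 3 * G.
Proof.
have N0 : 0 < 'C(n.+1, k.+1)%:R :> R by rewrite ltr0n bin_gt0 ltnS ltnW.
have m1 : 1 <= n.+1%:R :> R by rewrite ler1n.
set N : R := 'C(_, _)%:R in N0 *; set m : R := n.+1%:R in m1 *.
(* One bound for two purposes: it dominates each ordinary variable by [vertex_control], and also the
   smallest edge term, which is at most the average [G / N]. *)
pose g := Num.sqrt (4 * m * G / N).
have g2 : g ^+ 2 = 4 * m * G / N.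
  by rewrite sqr_sqrtr// divr_ge0 ?(ltW N0)// mulr_ge0 ?phase_energy_ge0//; lra.
have [e1 e1k] : exists e1 : {set 'I_n.+1}, #|e1| == k.+1.
  have : (0 < 'C(n.+1, k.+1))%N by rewrite bin_gt0 ltnS ltnW.
  rewrite -[in 'C(_, _)](card_ord n.+1) -(card_sets _ k.+1) card_gt0.
  by case/set0Pn => e1; rewrite inE; exists e1.
have [e0 e0g] : exists e0, u (phase theta e0) <= g.
  case: (@arg_minP _ R _ e1 (fun e => #|e| == k.+1) (fun e => u (phase theta e)) e1k).
  move=> e0 e0k e0min; exists e0.
  rewrite -(@ler_pXn2r _ 2)// ?nnegrE ?sqrtr_ge0// g2 ler_pdivlMr//.
  apply: (@le_trans _ _ G); last by have := phase_energy_ge0 u k theta; nra.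
  have -> : N = \sum_(e : {set 'I_n.+1} | #|e| == k.+1) 1.
    by rewrite sumr_const /N -[in LHS](card_ord n.+1) -(card_sets _ k.+1) cardsE.
  rewrite mulr_sumr; apply: ler_sum => e' e'k; rewrite mulr1.
  by rewrite lerXn2r ?nnegrE// e0min.
have ug (i : 'I_n) : u (theta (widen_ord (leqnSn n) i)) <= g.
  rewrite -(@ler_pXn2r _ 2)// ?nnegrE ?sqrtr_ge0// g2 ler_pdivlMr//.
  have : N <= m * 'C(n.-1, k)%:R by rewrite -natrM ler_nat binom_edges_le_pairs.
  have il : widen_ord (leqnSn n) i != ord_max.
    by apply/eqP => /(congr1 val) /= /eqP; rewrite ltn_eqF.
  have := vertex_control il; set v := u _ ^+ 2; have v0 : 0 <= v by rewrite sqr_ge0.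
  by set c := 'C(_, _)%:R; nra.
have u_sum (I : finType) (F : I -> R) : u (\sum_i F i) <= \sum_i u (F i).
  elim/big_rec2: _ => [|i a b _ ab]; first by rewrite u0.
  by apply: le_trans (u_subadd _ _) _; rewrite lerD2l.
have ueg : u (phase theta e) <= m * g.
  have -> : phase theta e = phase theta e0 + \sum_(i < n)
      (theta (widen_ord (leqnSn n) i) *+ (widen_ord (leqnSn n) i \in e)
       - theta (widen_ord (leqnSn n) i) *+ (widen_ord (leqnSn n) i \in e0)).
    by rewrite !phaseE sumrB; ring.
  apply: le_trans (u_subadd _ _) _.
  rewrite /m -natr1 mulrDl mul1r addrC lerD//.
  apply: le_trans (u_sum _ _) _.
  have -> : n%:R * g = \sum_(i < n) g by rewrite sumr_const card_ord mulr_natl.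
  apply: ler_sum => i _; apply: le_trans (ug i).
  by do 2 case: (_ \in _); rewrite ?mulr1n ?mulr0n ?subrr ?subr0 ?sub0r ?evenu ?u0.
rewrite -ler_pdivlMr//; apply: (@le_trans _ _ ((m * g) ^+ 2)).
  by rewrite lerXn2r ?nnegrE// mulr_ge0 ?sqrtr_ge0//; lra.
by rewrite exprMn g2 le_eqVlt; apply/orP; left; apply/eqP; field; rewrite gt_eqF.
Qed.

Lemma phase_set0 : phase theta finset.set0 = theta ord_max.
Proof. by rewrite /phase finset.setU0 big_set1. Qed.

Lemma variable_control i :
  u (theta i) ^+ 2 * 'C(n.+1, k.+1)%:R <= 4 * n.+1%:R ^+ 3 * G.
Proof.
have [->|il] := eqVneq i ord_max; first by rewrite -phase_set0 phase_control.
have m1 : 1 <= n.+1%:R :> R by rewrite ler1n.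
have : 'C(n.+1, k.+1)%:R <= n.+1%:R * 'C(n.-1, k)%:R :> R.
  by rewrite -natrM ler_nat binom_edges_le_pairs.
have := vertex_control il; set v := u _ ^+ 2; have v0 : 0 <= v by rewrite sqr_ge0.
have : n.+1%:R <= n.+1%:R ^+ 3 :> R by rewrite -[leLHS]expr1 ler_weXn2l.
set m : R := n.+1%:R in m1 *; set c := 'C(_, k)%:R; set N := 'C(_, _)%:R => mm vc Nc.
apply: le_trans (ler_wpM2l v0 Nc) _; rewrite mulrCA.
apply: (@le_trans _ _ (m * (4 * G))); first by rewrite ler_wpM2l//; lra.
by have := phase_energy_ge0 u k theta; nra.
Qed.

End phase_control.

(** * Exponential sums and exact Fourier inversion *)

Section cis.
Variable R : realType.
Local Open Scope complex_scope.
Implicit Types x y : R.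

Definition cis x : R[i] := cos x +i* sin x.

Lemma cis0 : cis 0 = 1.
Proof. by rewrite /cis cos0 sin0. Qed.

Lemma cisD x y : cis (x + y) = cis x * cis y.
Proof. by rewrite /cis cosD sinD; simpc; congr (_ +i* _); ring. Qed.

Lemma cis_sum (I : Type) (r : seq I) (P : pred I) (F : I -> R) :
  cis (\sum_(i <- r | P i) F i) = \prod_(i <- r | P i) cis (F i).
Proof. exact: (big_morph cis cisD cis0). Qed.

Lemma cisMn x n : cis (x *+ n) = cis x ^+ n.
Proof. by elim: n => [|n IH]; rewrite ?mulr0n ?cis0 ?expr0// mulrS exprS cisD IH. Qed.

Lemma cis2pi : cis (pi *+ 2) = 1.
Proof. by rewrite /cis cos2pi sin2pi. Qed.

Lemma cis_neq1 x : 0 < `|x| < 2 * pi -> cis x != 1.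
Proof.
move=> /andP[x0 xpi]; apply/negP => /eqP [] c1 _.
have s0 : 0 < sin (`|x| / 2) by apply: sin_gt0_pi; lra.
have := cos_mulr2n (`|x| / 2); have -> : `|x| / 2 *+ 2 = `|x| by field.
rewrite cos_norm c1 cos2sin2.
by nra.
Qed.

Lemma normc_cis x : normc (cis x) = 1.
Proof. by rewrite /= cos2Dsin2 sqrtr1. Qed.

(** A full geometric sum over roots of unity. Two exponents between 0 and [A.*2] differ by less than
    the number [A.*2.+1] of grid points, so distinct ones cannot alias. *)
Lemma sum_cis_grid A (z : R) (c c0 : nat) : (c <= A.*2)%N -> (c0 <= A.*2)%N ->
  \sum_(t < A.*2.+1) cis (gridpt (2 * pi / A.*2.+1%:R) t * (c%:R - c0%:R)) =
  (c == c0)%:R * A.*2.+1%:R :> R[i].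
Proof.
set M := A.*2.+1 => cA c0A; set h := 2 * pi / M%:R; set w := c%:R - c0%:R.
have M0 : 0 < M%:R :> R by rewrite ltr0n.
have [cc|cc] := eqVneq c c0.
  rewrite mul1r (eq_bigr (fun=> 1)) => [|t _]; last by rewrite /w cc subrr mulr0 cis0.
  by rewrite sumr_const card_ord.
rewrite mul0r; pose om := cis (h * w).
have tE (t : 'I_M) : cis (gridpt h t * w) = cis (- (A%:R * h * w)) * om ^+ t.
  by rewrite -cisMn -cisD; congr cis; rewrite /gridpt -mulr_natr; ring.
under eq_bigr do rewrite tE.
rewrite -mulr_sumr; apply/eqP; rewrite mulf_eq0; apply/orP; right.
have w_norm : 0 < `|w| <= A.*2%:R.
  rewrite normr_gt0 subr_eq0 eqr_nat cc /= /w.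
  have [lc|lc] := leqP c c0.
    by rewrite distrC -natrB// ger0_norm// ler_nat; lia.
  by rewrite -natrB ?(ltnW lc)// ger0_norm// ler_nat; lia.
have om1 : om != 1.
  apply: cis_neq1; case/andP: w_norm => w0 wA; rewrite normrM.
  have pi0 := pi_gt0 R.
  have h0 : 0 < h by rewrite divr_gt0// mulr_gt0.
  rewrite gtr0_norm// mulr_gt0//=.
  apply: (@le_lt_trans _ _ (h * A.*2%:R)); first by rewrite ler_pM2l.
  have -> : 2 * pi = h * M%:R by rewrite /h divfK// gt_eqF.
  by rewrite ltr_pM2l// ltr_nat.
have omM : om ^+ M = 1.
  have E : h * w *+ M = pi *+ 2 *+ c - pi *+ 2 *+ c0.
    rewrite -(mulr_natr _ M) -(mulr_natr _ c) -(mulr_natr _ c0) -(mulr_natr pi 2) /h /w.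
    by field; rewrite gt_eqF.
  have cis2piM q : cis (pi *+ 2 *+ q) = 1 by rewrite cisMn cis2pi expr1n.
  by rewrite -cisMn E cisD cis2piM -(cis2piM c0) -cisD subrr cis0.
have /eqP := subrX1 om M; rewrite omM subrr eq_sym mulf_eq0 subr_eq0 (negbTE om1) /=.
by [].
Qed.

Definition bern_cf p y : R[i] := (1 - p)%:C * cis (- (p * y)) + p%:C * cis ((1 - p) * y).

Lemma bern_cfE p y : bern_cf p y = cis (- (p * y)) * (p%:C * cis y + (1 - p)%:C).
Proof.
rewrite /bern_cf mulrDr mulrCA -cisD addrC [cis _ * _%:C]mulrC; congr (_ * cis _ + _).
by ring.
Qed.

End cis.

Section fourier.
Variables (R : realType) (n k d : nat).
Local Open Scope complex_scope.
Implicit Types (e : {set 'I_n.+1}) (H : {set {set 'I_n.+1}}) (theta : 'I_n.+1 -> R).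
Local Notation N := 'C(n.+1, k.+1).

Definition deg H (i : 'I_n.+1) : nat := #|[set e in H | i \in e]|.

Lemma degE H i : deg H i = (\sum_(e in H) (i \in e))%N.
Proof.
rewrite /deg -sum1_card (eq_bigl (fun e => (e \in H) && (i \in e))) => [|e]; last first.
  by rewrite inE.
by rewrite big_mkcondr; apply: eq_bigr => e _; case: (_ \in _).
Qed.

Lemma sum_deg H : uniform_hypergraph k.+1 H -> (\sum_i deg H i = #|H| * k.+1)%N.
Proof.
move=> /forallP unif; under eq_bigr do rewrite degE.
rewrite exchange_big /= -sum_nat_const; apply: eq_bigr => e eH.
have /implyP/(_ eH)/eqP <- := unif e.
by rewrite -sum1_card [RHS]big_mkcond; apply: eq_bigr => i _; case: (_ \in _).
Qed.

(* The Fourier exponents: the last variable carries the number of edges. *)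
Definition fourier_deg H (i : 'I_n.+1) : nat := if i == ord_max then #|H| else deg H i.

Lemma uniform_card_le H : uniform_hypergraph k.+1 H -> (#|H| <= N)%N.
Proof.
move=> /forallP unif; rewrite -[X in 'C(X, _)](card_ord n.+1) -(card_sets _ k.+1).
by apply/subset_leq_card/fintype.subsetP => e eH; rewrite inE; exact: (implyP (unif e)).
Qed.

Lemma fourier_deg_le H i : uniform_hypergraph k.+1 H -> (fourier_deg H i <= N)%N.
Proof.
move=> unif; apply: leq_trans (uniform_card_le unif); rewrite /fourier_deg; case: ifP => // _.
by apply/subset_leq_card/fintype.subsetP => e; rewrite inE => /andP[].
Qed.

Lemma sum_phase_hypergraph theta H :
  \sum_(e in H) phase theta e = \sum_i theta i * (fourier_deg H i)%:R.
Proof.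
have E e : phase theta e = \sum_i theta i * (i \in ord_max |: e)%:R.
  by rewrite /phase big_mkcond; apply: eq_bigr => i _; case: ifP; rewrite ?mulr1 ?mulr0.
under eq_bigr do rewrite E.
rewrite exchange_big; apply: eq_bigr => i _ /=; rewrite -mulr_sumr -natr_sum; congr (_ * _%:R).
rewrite /fourier_deg; case: eqP => [->|il].
  rewrite -sum1_card; apply: eq_bigr => e _; by rewrite !inE eqxx.
by rewrite degE; apply: eq_bigr => e _; rewrite !inE; case: eqP il.
Qed.

Lemma sum_phase_edges theta : \sum_(e : {set 'I_n.+1} | #|e| == k.+1) phase theta e =
  \sum_i theta i * (if i == ord_max then N else 'C(n, k))%:R.
Proof.
rewrite (eq_bigl (fun e => e \in [set e : {set 'I_n.+1} | #|e| == k.+1])) => [|e]; last first.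
  by rewrite inE.
rewrite sum_phase_hypergraph; apply: eq_bigr => i _; congr (_ * _%:R).
rewrite /fourier_deg card_sets card_ord; case: ifP => // _.
have -> : 'C(n, k) = 'C(#|'I_n.+1|.-1, k) by rewrite card_ord.
rewrite /deg -(card_sets_with k i).
by apply: eq_card => e; rewrite !inE.
Qed.

Lemma prod_bern_cf p theta :
  \prod_(e : {set 'I_n.+1} | #|e| == k.+1) bern_cf p (phase theta e) =
  cis (- (p * \sum_(e : {set 'I_n.+1} | #|e| == k.+1) phase theta e)) *
  \sum_(H : {set {set 'I_n.+1}} | uniform_hypergraph k.+1 H)
    (p ^+ #|H| * (1 - p) ^+ (N - #|H|))%:C * cis (\sum_(e in H) phase theta e).
Proof.
under eq_bigr do rewrite bern_cfE.
rewrite big_split /= -cis_sum; congr (cis _ * _).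
  by rewrite mulr_sumr -sumrN.
(* The product is extended to all vertex sets so that it expands over all families [H]; the value 0
   of [F] on sets of the wrong size removes the non-uniform ones. *)
pose F e : R[i] := if #|e| == k.+1 then p%:C * cis (phase theta e) else 0.
pose G e : R[i] := if #|e| == k.+1 then (1 - p)%:C else 1.
rewrite big_mkcond (eq_bigr (fun e => F e + G e)) => [|e _]; last first.
  by rewrite /F /G; case: ifP => //; rewrite add0r.
rewrite bigA_distr [RHS]big_mkcond; apply: eq_big => // H _ /=.
case: ifPn => [unif|]; last first.
  rewrite negb_forall => /existsP[e]; rewrite negb_imply => /andP[eH ek].
  by rewrite (bigD1 e)//= eH /F (negbTE ek) mul0r.
rewrite (bigID (mem H)) /=.
have /forallP ukH := unif.
rewrite (eq_bigr (fun e => p%:C * cis (phase theta e))) => [|e eH]; last first.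
  by rewrite eH /F (implyP (ukH e) eH).
rewrite big_split /= prodr_const -cis_sum.
rewrite [X in _ * X](eq_bigr (fun e => G e)) => [|e /negbTE ->//].
rewrite /G -big_mkcondr /=.
have -> : \prod_(e | (e \notin H) && (#|e| == k.+1)) (1 - p)%:C = (1 - p)%:C ^+ (N - #|H|).
  rewrite prodr_const -[X in 'C(X, _)](card_ord n.+1) -(card_sets _ k.+1) -cardsDS.
    by congr (_ ^+ _); apply: eq_card => e; rewrite !inE.
  by apply/fintype.subsetP => e eH; rewrite inE; exact: (implyP (ukH e) eH).
by rewrite rmorphM !rmorphXn /= mulrAC.
Qed.

(** The handshake identity [sum_deg] is used both ways: it gives the last degree from the edge count
    and the other degrees, and the edge count from all degrees. *)
Lemma regularE E H : (n.+1 * d = E * k.+1)%N -> uniform_hypergraph k.+1 H ->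
  [forall i, fourier_deg H i == (if i == ord_max then E else d)] = regular_hypergraph d H.
Proof.
move=> nd unif; apply/forallP/forallP => H_deg.
  have HE : #|H| = E by have := H_deg ord_max; rewrite /fourier_deg eqxx => /eqP.
  have degd i : i != ord_max -> deg H i = d.
    by move=> il; have := H_deg i; rewrite /fourier_deg (negbTE il) => /eqP.
  move=> i; have [->|il] := eqVneq i ord_max; last by apply/eqP/degd.
  have := sum_deg unif; rewrite (bigD1 ord_max) //= (eq_bigr (fun=> d)) => [|j /degd//].
  rewrite sum_nat_const (eq_card (B := predC1 ord_max)) // cardC1 card_ord HE -nd.
  by rewrite /= mulSn => /addIn/eqP.
have degd i : deg H i = d by apply/eqP/H_deg.
move=> i; rewrite /fourier_deg; case: ifP => _; last by rewrite degd.
have := sum_deg unif; rewrite (eq_bigr (fun=> d)) => [|j _]; last exact: degd.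
by rewrite sum_nat_const card_ord nd => /eqP; rewrite eqn_pmul2r// eq_sym.
Qed.

Lemma fourier_inversion p E A : (n.+1 * d = E * k.+1)%N -> (E <= N)%N -> (d <= N)%N ->
  (N <= A.*2)%N -> p * N%:R = E%:R -> p * 'C(n, k)%:R = d%:R ->
  \sum_(f : {ffun 'I_n.+1 -> 'I_A.*2.+1}) \prod_(e : {set 'I_n.+1} | #|e| == k.+1)
     bern_cf p (phase (fun i => gridpt (2 * pi / A.*2.+1%:R) (f i)) e) =
  (A.*2.+1%:R ^+ n.+1 * (p ^+ E * (1 - p) ^+ (N - E))
    * (num_regular_uniform n.+1 k.+1 d)%:R : R)%:C.
Proof.
move=> nd EN dN NA pN pd; set h := _ / _; set M := A.*2.+1.
pose c0 (i : 'I_n.+1) := if i == ord_max then E else d.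
(* Centring the Bernoulli variables is the same as subtracting the target exponents: the expected
   edge count is [E] and the expected degree is [d]. *)
have peak theta : p * (\sum_(e : {set 'I_n.+1} | #|e| == k.+1) phase theta e) =
    \sum_i theta i * (c0 i)%:R.
  rewrite sum_phase_edges mulr_sumr; apply: eq_bigr => i _; rewrite mulrCA; congr (_ * _).
  by rewrite /c0; case: ifP.
under eq_bigr => f _.
  rewrite prod_bern_cf peak mulr_sumr.
  under eq_bigr => H _ do rewrite mulrCA -cisD sum_phase_hypergraph [- _ + _]addrC -sumrB cis_sum.
  over.
rewrite exchange_big /=.
have termE H : uniform_hypergraph k.+1 H ->
    \sum_(f : {ffun 'I_n.+1 -> 'I_M}) (p ^+ #|H| * (1 - p) ^+ (N - #|H|))%:C *
      \prod_i cis (gridpt h (f i) * (fourier_deg H i)%:R - gridpt h (f i) * (c0 i)%:R) =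
    if regular_hypergraph d H then
      (M%:R ^+ n.+1 * (p ^+ E * (1 - p) ^+ (N - E)) : R)%:C else 0.
  move=> unif; rewrite -mulr_sumr.
  pose g (i : 'I_n.+1) (t : 'I_M) :=
    cis (gridpt h t * (fourier_deg H i)%:R - gridpt h t * (c0 i)%:R).
  rewrite -(bigA_distr_bigA g) /g.
  rewrite (eq_bigr (fun i => (fourier_deg H i == c0 i)%:R * M%:R)) => [|i _]; last first.
    under eq_bigr do rewrite -mulrBr.
    rewrite sum_cis_grid//; first by apply: leq_trans NA; exact: fourier_deg_le.
    by apply: leq_trans NA; rewrite /c0; case: ifP.
  rewrite -(regularE nd unif) big_split /= prodr_const card_ord.
  case: ifPn => [/forallP H_deg|].
    rewrite big1 => [|i _]; last by rewrite (eqP (H_deg i)) eqxx.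
    have -> : #|H| = E by have := H_deg ord_max; rewrite /fourier_deg eqxx => /eqP.
    by rewrite mul1r mulrC [RHS]rmorphM rmorphXn rmorph_nat.
  rewrite negb_forall => /existsP[i /negbTE Hi].
  by rewrite (bigD1 i)//= Hi !mul0r mulr0.
rewrite (eq_bigr _ termE) -big_mkcondr /= sumr_const.
by rewrite [RHS]rmorphM rmorph_nat mulr_natr /num_regular_uniform cardsE.
Qed.

End fourier.

(** * Estimates for sine, cosine and the Bernoulli characteristic function *)

Section trig_bounds.
Variable R : realType.
Implicit Types x y : R.

Lemma is_derive_ge0_le (f df : R -> R) x : 0 <= x ->
  (forall y, is_derive y 1 f (df y)) -> (forall y, 0 <= y -> 0 <= df y) -> f 0 <= f x.
Proof.
move=> x0 fd df0; rewrite -subr_ge0.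
have [y + ->] := @is_derive_mvt R f df 0 x x0 (fun y _ => fd y).
by rewrite in_itv /= => /andP[y0 _]; rewrite mulr_ge0 ?df0// subr0.
Qed.

Lemma sin_le x : 0 <= x -> sin x <= x.
Proof.
move=> x0.
have D y : is_derive y 1 (fun y => y - sin y) (1 - cos y).
  by apply: is_derive_eq; rewrite /GRing.scale /=; ring.
have := is_derive_ge0_le x0 D; rewrite sin0 subr0 subr_ge0; apply => y _.
by rewrite subr_ge0 cos_le1.
Qed.

Lemma cos_ge x : 0 <= x -> 1 - x ^+ 2 / 2 <= cos x.
Proof.
move=> x0.
have D y : is_derive y 1 (fun y => cos y + y ^+ 2 / 2) (y - sin y).
  by apply: is_derive_eq; rewrite /GRing.scale /=; field.
have := is_derive_ge0_le x0 D; rewrite cos0 expr0n /= mul0r addr0 => H.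
by rewrite lerBlDr; apply: H => y y0; rewrite subr_ge0 sin_le.
Qed.

Lemma sin_ge x : 0 <= x -> x - x ^+ 3 / 6 <= sin x.
Proof.
move=> x0.
have D y : is_derive y 1 (fun y => sin y - y + y ^+ 3 / 6) (cos y - 1 + y ^+ 2 / 2).
  by apply: is_derive_eq; rewrite /GRing.scale /=; field.
have := is_derive_ge0_le x0 D; rewrite sin0 expr0n /= mul0r addr0 subr0 => H.
suff : 0 <= sin x - x + x ^+ 3 / 6 by lra.
by apply: H => y /cos_ge; lra.
Qed.

(** Integrating up from [sin <= 1] gives a cubic remainder rather than the sharp quartic one, which
    matches the cubic precision of the sine estimate. *)
Lemma cos_le x : 0 <= x -> cos x <= 1 - x ^+ 2 / 2 + x ^+ 3 / 6.
Proof.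
have cos1 y : 0 <= y -> 1 - y <= cos y.
  move=> y0; have D (z : R) : is_derive z 1 (fun y => cos y + y) (1 - sin z).
    by apply: is_derive_eq; rewrite /GRing.scale /=; ring.
  have := is_derive_ge0_le y0 D; rewrite cos0 addr0 => H.
  by rewrite lerBlDr; apply: H => z _; rewrite subr_ge0 sin_le1.
have sin2 y : 0 <= y -> y - y ^+ 2 / 2 <= sin y.
  move=> y0; have D (z : R) : is_derive z 1 (fun y => sin y - y + y ^+ 2 / 2) (cos z - 1 + z).
    by apply: is_derive_eq; rewrite /GRing.scale /=; field.
  have := is_derive_ge0_le y0 D; rewrite sin0 expr0n /= mul0r addr0 subr0 => H.
  suff : 0 <= sin y - y + y ^+ 2 / 2 by lra.
  by apply: H => z /cos1; lra.
move=> x0.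
have D y : is_derive y 1 (fun y => - cos y - y ^+ 2 / 2 + y ^+ 3 / 6)
    (sin y - y + y ^+ 2 / 2).
  by apply: is_derive_eq; rewrite /GRing.scale /=; field.
have := is_derive_ge0_le x0 D; rewrite cos0 !expr0n /= !mul0r subr0 addr0 => H.
suff : -1 <= - cos x - x ^+ 2 / 2 + x ^+ 3 / 6 by lra.
by apply: H => y /sin2; lra.
Qed.

Lemma sin_sub_norm_le x : `|sin x - x| <= `|x| ^+ 3 / 6.
Proof.
wlog x0 : x / 0 <= x.
  move=> H; have [|x0] := leP 0 x; first exact: H.
  by have := H (- x); rewrite sinN -opprD !normrN; apply; lra.
have := sin_le x0; have := sin_ge x0 => s1 s2.
by rewrite (ger0_norm x0) ler0_norm; lra.
Qed.

Lemma cos_sub_norm_le x : `|cos x - (1 - x ^+ 2 / 2)| <= `|x| ^+ 3 / 6.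
Proof.
wlog x0 : x / 0 <= x.
  move=> H; have [|x0] := leP 0 x; first exact: H.
  by have := H (- x); rewrite cosN sqrrN normrN; apply; lra.
have := cos_ge x0; have := cos_le x0 => c1 c2.
by rewrite (ger0_norm x0) ger0_norm; lra.
Qed.

(** The range exceeds [pi] and so contains every grid point. At [|x| = 4] the cubic lower bound for
    the sine is exactly [|x| / 6]. *)
Lemma norm_le_sin x : `|x| <= 4 -> `|x| <= 6 * `|sin (x / 2)|.
Proof.
wlog x0 : x / 0 <= x.
  move=> H; have [|x0] := leP 0 x; first exact: H.
  by have := H (- x); rewrite mulNr sinN !normrN; apply; lra.
rewrite (ger0_norm x0) => x4.
have := @sin_ge (x / 2) (ltac:(lra)); have := ler_norm (sin (x / 2)).
have : x ^+ 3 <= 16 * x by rewrite exprSr ler_wpM2r//; nra.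
have -> : (x / 2) ^+ 3 = x ^+ 3 / 8 by field.
by lra.
Qed.

(** Measures how far the decay rate of [bern_cf] can fall short of the Gaussian rate; for small
    phases the deficit fits into the damping. *)
Lemma sin_half_sqr_ge x : `|x| <= 1 -> x ^+ 2 * (1 - x ^+ 2 / 12) <= 4 * sin (x / 2) ^+ 2.
Proof.
wlog x0 : x / 0 <= x.
  move=> H; have [|x0] := leP 0 x; first exact: H.
  by have := H (- x); rewrite mulNr sinN !sqrrN normrN; apply; lra.
rewrite (ger0_norm x0) => x1; have := @sin_ge (x / 2) (ltac:(lra)).
have -> : x / 2 - (x / 2) ^+ 3 / 6 = x / 2 * (1 - x ^+ 2 / 24) by field.
move=> H; have y0 : 0 <= x / 2 * (1 - x ^+ 2 / 24) by nra.
have : (x / 2 * (1 - x ^+ 2 / 24)) ^+ 2 <= sin (x / 2) ^+ 2.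
  by rewrite lerXn2r ?nnegrE// (le_trans y0).
have -> : (x / 2 * (1 - x ^+ 2 / 24)) ^+ 2 =
  (x ^+ 2 * (1 - x ^+ 2 / 12) + x ^+ 2 * (x ^+ 2 / 24) ^+ 2) / 4 by field.
have : 0 <= x ^+ 2 * (x ^+ 2 / 24) ^+ 2 by rewrite mulr_ge0 ?sqr_ge0.
by lra.
Qed.

Lemma norm_sinD_le x y : `|sin (x + y)| <= `|sin x| + `|sin y|.
Proof.
rewrite sinD; apply: le_trans (ler_normD _ _) _; rewrite !normrM.
by rewrite lerD// ?ler_piMr ?ler_piMl ?cos_max.
Qed.

End trig_bounds.

Section cf_bounds.
Variable R : realType.
Local Open Scope complex_scope.
Implicit Types (p y : R).

Lemma normc_ge0 (z : R[i]) : 0 <= normc z.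
Proof. by case: z => a b; exact: sqrtr_ge0. Qed.

Lemma normc_real (x : R) : normc x%:C = `|x|.
Proof. by rewrite /= expr0n addr0 sqrtr_sqr. Qed.

Lemma normcD (z w : R[i]) : normc (z + w) <= normc z + normc w.
Proof. exact: (le_normcD (z : Rcomplex R) w). Qed.

Lemma normc_prod (I : Type) (r : seq I) (P : pred I) (F : I -> R[i]) :
  normc (\prod_(i <- r | P i) F i) = \prod_(i <- r | P i) normc (F i).
Proof. by apply: big_morph; [exact: normcM|exact: normc1]. Qed.

Lemma normc_sum_le (I : Type) (r : seq I) (P : pred I) (F : I -> R[i]) :
  normc (\sum_(i <- r | P i) F i) <= \sum_(i <- r | P i) normc (F i).
Proof.
elim/big_rec2: _ => [|i a b _ ab]; first by rewrite normc0.
by apply: le_trans (normcD _ _) _; rewrite lerD2l.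
Qed.

Lemma normc_bern_cf_sqr p y :
  normc (bern_cf p y) ^+ 2 = 1 - 4 * (p * (1 - p)) * sin (y / 2) ^+ 2.
Proof.
rewrite bern_cfE normcM normc_cis mul1r /normc /cis; simpc; rewrite sqr_sqrtr; last first.
  by rewrite addr_ge0 ?sqr_ge0.
have cy : cos y = 1 - 2 * sin (y / 2) ^+ 2.
  rewrite [in LHS](_ : y = y / 2 *+ 2); last by field.
  by rewrite cos_mulr2n cos2sin2; ring.
have sy : sin y ^+ 2 = 1 - cos y ^+ 2 by exact: sin2cos2.
rewrite exprMn sy cy; ring.
Qed.

Lemma normc_bern_cf_le p y : 0 <= p <= 1 ->
  normc (bern_cf p y) <= expR (- (2 * (p * (1 - p)) * sin (y / 2) ^+ 2)).
Proof.
move=> p01; rewrite -(@ler_pXn2r _ 2)// ?nnegrE ?normc_ge0 ?expR_ge0//.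
rewrite normc_bern_cf_sqr -expRM_natr.
by apply: le_trans (expR_ge1Dx _); lra.
Qed.

Lemma expRN_sub_le (x : R) : 0 <= x -> 0 <= expR (- x) - (1 - x) <= x ^+ 2 / 2.
Proof.
move=> x0; have := expR_ge1Dx (- x) => lb; apply/andP; split; first lra.
have D y : is_derive y 1 (fun y : R => y ^+ 2 / 2 - expR (- y) - y) (y + expR (- y) - 1).
  by apply: is_derive_eq; rewrite /GRing.scale /=; field.
have D0 y : 0 <= y -> 0 <= y + expR (- y) - 1 by have := expR_ge1Dx (- y); lra.
by have := is_derive_ge0_le x0 D D0; rewrite /= oppr0 expR0 expr0n /=; lra.
Qed.

(** Centring cancels the linear terms, and the quadratic ones agree because the variance is
    [p (1-p)]. The factor [p (1-p)] in the error matters: summed over the edges, the errors are at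
    most the largest phase times Q, even for tiny [p]. *)
Lemma normc_bern_cf_sub_gauss p y : 0 <= p <= 1 -> `|y| <= 1 ->
  normc (bern_cf p y - (gauss (p * (1 - p)) y)%:C) <= p * (1 - p) * `|y| ^+ 3.
Proof.
move=> p01 y1; set q := p * (1 - p).
have q0 : 0 <= q by rewrite /q; nra.
have q1 : q <= 1 by rewrite /q; nra.
have y0 := normr_ge0 y; set Y := `|y| in y0 y1 *.
have YE : y ^+ 2 = Y ^+ 2 by rewrite /Y real_normK ?num_real.
have Y3 : 0 <= Y ^+ 3 by rewrite exprn_ge0.
have -> : bern_cf p y - (gauss q y)%:C =
    ((1 - p) * (cos (p * y) - (1 - (p * y) ^+ 2 / 2))
     + p * (cos ((1 - p) * y) - (1 - ((1 - p) * y) ^+ 2 / 2))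
     - (gauss q y - (1 - q * y ^+ 2 / 2)))%:C +
    (0 +i* (- (1 - p) * (sin (p * y) - p * y) + p * (sin ((1 - p) * y) - (1 - p) * y))).
  rewrite /bern_cf /cis cosN sinN; simpc; congr (_ +i* _); rewrite /q; first by field.
  by ring.
have np a : 0 <= a <= 1 -> `|a * y| ^+ 3 <= a ^+ 2 * Y ^+ 3.
  move=> a01; rewrite normrM exprMn ger0_norm; last lra.
  by rewrite ler_wpM2r// exprS ler_piMl ?sqr_ge0; lra.
have p2 : p ^+ 2 * Y ^+ 3 <= p * Y ^+ 3 by rewrite ler_wpM2r//; nra.
have p2' : (1 - p) ^+ 2 * Y ^+ 3 <= (1 - p) * Y ^+ 3 by rewrite ler_wpM2r//; nra.
have ps := np p p01; have ps' := np (1 - p) (ltac:(lra)).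
have c1 := cos_sub_norm_le (p * y); have c2 := cos_sub_norm_le ((1 - p) * y).
have s1 := sin_sub_norm_le (p * y); have s2 := sin_sub_norm_le ((1 - p) * y).
have g1 : `|gauss q y - (1 - q * y ^+ 2 / 2)| <= q * Y ^+ 3 / 8.
  have qy0 : 0 <= q * y ^+ 2 / 2 by rewrite divr_ge0// mulr_ge0 ?sqr_ge0.
  have /andP[lo up] := expRN_sub_le qy0; rewrite /gauss ger0_norm//.
  apply: le_trans up _; rewrite YE.
  have -> : (q * Y ^+ 2 / 2) ^+ 2 / 2 = q * (q * Y) * (Y ^+ 3) / 8 by field.
  rewrite ler_pM2r; last lra.
  by rewrite ler_wpM2r// ler_piMr//; nra.
have qE : q * Y ^+ 3 = (1 - p) * (p * Y ^+ 3) by rewrite /q; ring.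
have qE' : q * Y ^+ 3 = p * ((1 - p) * Y ^+ 3) by rewrite /q; ring.
have sum2 (a b A : R) : 0 <= a -> `|A| <= b -> `|a * A| <= a * b.
  by move=> a0 Ab; rewrite normrM (ger0_norm a0) ler_wpM2l.
have np0 : 0 <= 1 - p by lra.
have pp0 : 0 <= p by lra.
apply: le_trans (normcD _ _) _; rewrite normc_real /= expr0n add0r sqrtr_sqr.
have C1 : `|(1 - p) * (cos (p * y) - (1 - (p * y) ^+ 2 / 2))| <= q * Y ^+ 3 / 6.
  by rewrite qE -[leRHS]mulrA; apply: sum2 => //; lra.
have C2 : `|p * (cos ((1 - p) * y) - (1 - ((1 - p) * y) ^+ 2 / 2))| <= q * Y ^+ 3 / 6.
  by rewrite qE' -[leRHS]mulrA; apply: sum2 => //; lra.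
have S1 : `|- (1 - p) * (sin (p * y) - p * y)| <= q * Y ^+ 3 / 6.
  by rewrite mulNr normrN qE -[leRHS]mulrA; apply: sum2 => //; lra.
have S2 : `|p * (sin ((1 - p) * y) - (1 - p) * y)| <= q * Y ^+ 3 / 6.
  by rewrite qE' -[leRHS]mulrA; apply: sum2 => //; lra.
have qY : 0 <= q * Y ^+ 3 by rewrite mulr_ge0.
apply: (@le_trans _ _ (q * Y ^+ 3 / 6 + q * Y ^+ 3 / 6 + q * Y ^+ 3 / 8
  + (q * Y ^+ 3 / 6 + q * Y ^+ 3 / 6))); last by lra.
rewrite lerD//; last by apply: le_trans (ler_normD _ _) _; rewrite lerD.
apply: le_trans (ler_normD _ _) _; rewrite normrN lerD//.
by apply: le_trans (ler_normD _ _) _; rewrite lerD.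
Qed.

End cf_bounds.

(** * The product of characteristic functions against the Gaussian, pointwise *)

Section pointwise.
Variables (R : realType) (n k : nat) (p : R).
Hypotheses (n_gt0 : (0 < n)%N) (k_lt : (k < n)%N) (p_gt0 : 0 < p) (p_lt1 : p < 1).
Local Open Scope complex_scope.
Implicit Types (e : {set 'I_n.+1}) (theta : 'I_n.+1 -> R).
Local Notation q := (p * (1 - p)).
Local Notation m := (n.+1%:R : R).
Local Notation V := (q * 'C(n.+1, k.+1)%:R).
Local Notation Q theta := (q * phase_energy id k theta).

(** Factors are exchanged one at a time. The common majorant [g] bounds those not being exchanged,
    so that the decay of the whole product survives in the error. *)
Lemma normc_prodB_le (I : Type) (r : seq I) (P : pred I) (a b : I -> R[i]) (g : I -> R) :
  (forall i, 0 < g i) -> (forall i, P i -> normc (a i) <= g i) ->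
  (forall i, P i -> normc (b i) <= g i) ->
  normc (\prod_(i <- r | P i) a i - \prod_(i <- r | P i) b i) <=
    (\prod_(i <- r | P i) g i) * \sum_(i <- r | P i) normc (a i - b i) / g i.
Proof.
move=> g0 ag bg.
pose K A B (G S : R) := [/\ normc A <= G, normc (A - B) <= G * S & 0 <= G].
suff : K (\prod_(i <- r | P i) a i) (\prod_(i <- r | P i) b i)
    (\prod_(i <- r | P i) g i) (\sum_(i <- r | P i) normc (a i - b i) / g i) by case.
elim: r => [|i r]; first by rewrite !big_nil; split; rewrite ?normc1 ?subrr ?normc0 ?mulr0.
rewrite !big_cons; case: ifP => // Pi; move: (\prod_(j <- r | P j) a j) => A.
move: (\prod_(j <- r | P j) b j) (\prod_(j <- r | P j) g j) => B G.
move: (\sum_(j <- r | P j) _) => S [AG ABS G0].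
have gi := g0 i; split; last by rewrite mulr_ge0// ltW.
  by rewrite normcM ler_pM ?normc_ge0 ?ag.
have -> : a i * A - b i * B = (a i - b i) * A + b i * (A - B) by ring.
apply: le_trans (normcD _ _) _; rewrite !normcM mulrDr lerD//.
  have -> : g i * G * (normc (a i - b i) / g i) = normc (a i - b i) * G.
    by field; rewrite gt_eqF.
  by rewrite ler_wpM2l ?normc_ge0.
by rewrite -mulrA ler_pM ?normc_ge0 ?bg.
Qed.

Let q_gt0 : 0 < q. Proof. by rewrite mulr_gt0 ?subr_gt0. Qed.
Let m_ge1 : 1 <= m. Proof. by rewrite ler1n. Qed.
Let V_gt0 : 0 < V.
Proof. by rewrite mulr_gt0 ?q_gt0// ltr0n bin_gt0 ltnS ltnW. Qed.

Lemma prod_expR_phase theta c :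
  \prod_(e : {set 'I_n.+1} | #|e| == k.+1) expR (- (c * phase theta e ^+ 2 / 2)) =
  expR (- (c * phase_energy id k theta / 2)).
Proof.
rewrite -expR_sum sumrN; congr (expR (- _)).
by rewrite /phase_energy mulr_sumr mulr_suml.
Qed.

(** By [variable_control] with the sine, one variable beyond [m ^- 2] forces the sine energy up to
    [N / (144 m^7)]; the decay rate of the product is [2 q] times this energy. *)
Lemma prod_bern_cf_far theta i : m ^- 2 < `|theta i| <= 4 ->
  normc (\prod_(e : {set 'I_n.+1} | #|e| == k.+1) bern_cf p (phase theta e)) <=
  expR (- (V / (72 * m ^+ 7))).
Proof.
move=> /andP[ti ti4]; have m1 := m_ge1; have q0 := q_gt0.
pose u (x : R) := `|sin (x / 2)|.
have u0 : u 0 = 0 by rewrite /u mul0r sin0 normr0.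
have u_ge0 x : 0 <= u x by exact: normr_ge0.
have evenu x : u (- x) = u x by rewrite /u mulNr sinN normrN.
have u_sub x y : u (x + y) <= u x + u y by rewrite /u mulrDl norm_sinD_le.
have := @variable_control R n k u n_gt0 k_lt u0 u_ge0 evenu u_sub theta i.
set G := phase_energy u k theta; set N : R := 'C(_, _)%:R => ctl.
rewrite normc_prod; apply: (@le_trans _ _
  (\prod_(e : {set 'I_n.+1} | #|e| == k.+1) expR (- (2 * q * u (phase theta e) ^+ 2)))).
  apply: ler_prod => e _; rewrite normc_ge0 /= /u real_normK ?num_real//.
  by apply: normc_bern_cf_le; rewrite !ltW.
rewrite -expR_sum sumrN -mulr_sumr -/(phase_energy u k theta) -/G ler_expR lerN2.
have -> : 2 * q * G = q * (2 * G) by ring.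
rewrite -[V / _]mulrA ler_pM2l//.
have um : m ^- 2 <= 6 * u (theta i) by apply: (le_trans (ltW ti)); exact: norm_le_sin.
have m20 : 0 < m ^- 2 by rewrite invr_gt0 exprn_gt0//; lra.
have u2 : m ^- 4 / 36 <= u (theta i) ^+ 2.
  have : (m ^- 2) ^+ 2 <= (6 * u (theta i)) ^+ 2.
    by rewrite lerXn2r ?nnegrE// ?mulr_ge0 ?u_ge0 ?ltW.
  rewrite exprVn -exprM exprMn (_ : 6 ^+ 2 = 36); last by ring.
  by move=> H; rewrite ler_pdivrMr// mulrC.
have N0 : 0 <= N by exact: ler0n.
have m0 : m != 0 by rewrite gt_eqF//; lra.
have : m ^- 4 / 36 * N <= 4 * m ^+ 3 * G by apply: le_trans ctl; rewrite ler_wpM2r.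
have -> : m ^- 4 / 36 * N = 4 * m ^+ 3 * (N / (144 * m ^+ 7)) by field.
rewrite ler_pM2l; last by rewrite mulr_gt0// exprn_gt0//; lra.
have -> : N / (72 * m ^+ 7) = 2 * (N / (144 * m ^+ 7)) by field.
by move=> NG; rewrite ler_pM2l.
Qed.

(** Serves to absorb the power 3/2 of Q, left over by the cubic errors, into an exponential. *)
Lemma mul_sqrt_le_expR (x : R) : 0 <= x -> x * Num.sqrt x <= 2 * expR x.
Proof.
move=> x0; have s0 := sqrtr_ge0 x; have s2 := sqr_sqrtr x0.
set s := Num.sqrt x in s0 s2 *.
have e2 : expR x = expR (x / 2) ^+ 2 by rewrite -expRM_natr; congr expR; field.
have := expR_ge1Dx (x / 2) => e1.
have : (1 + x / 2) ^+ 2 <= expR x by rewrite e2 lerXn2r ?nnegrE ?expR_ge0//; lra.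
have : s <= (1 + x) / 2 by have := sqr_ge0 (1 - s); nra.
by nra.
Qed.

Lemma prod_bern_cf_near theta : (forall i, `|theta i| <= m ^- 2) ->
  normc (\prod_(e : {set 'I_n.+1} | #|e| == k.+1) bern_cf p (phase theta e)
         - (expR (- (Q theta / 2)))%:C) <=
  1000 * m ^+ 4 / Num.sqrt V * expR (- ((1 - (2 * m)^-1) * Q theta / 2)).
Proof.
move=> th; have p0 := p_gt0; have p1 := p_lt1; have m1 := m_ge1; have q0 := q_gt0; have V0 := V_gt0.
have m0 : m != 0 by rewrite gt_eqF//; lra.
(* The damping [1 / (2 m)] is split in two: one half makes [g] a majorant of both factors, the other
   half absorbs the power of Q below. *)
set dl := (4 * m)^-1.
have dlm : dl * m = 4^-1 by rewrite /dl; field.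
have dl0 : 0 < dl by rewrite invr_gt0; lra.
have y_le e : `|phase theta e| <= m^-1.
  apply: le_trans (ler_norm_sum _ _ _) _; apply: (@le_trans _ _ (\sum_(i < n.+1) m ^- 2)).
    by rewrite [leLHS]big_mkcond; apply: ler_sum => i _; case: ifP.
  by rewrite sumr_const card_ord -mulr_natl le_eqVlt; apply/orP; left; apply/eqP; field.
have mV1 : m^-1 <= 1 by rewrite invf_le1//; lra.
have y1 e : `|phase theta e| <= 1 := le_trans (y_le e) mV1.
pose g e := expR (- ((1 - dl) * q * phase theta e ^+ 2 / 2)).
have g0 e : 0 < g e by exact: expR_gt0.
have p01 : 0 <= p <= 1 by rewrite !ltW.
have ag e : normc (bern_cf p (phase theta e)) <= g e.
  apply: le_trans (normc_bern_cf_le _ p01) _; rewrite ler_expR lerN2.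
  have := sin_half_sqr_ge (y1 e); set y := phase theta e => sy.
  have : y ^+ 2 <= dl * 12.
    have yy : y ^+ 2 <= (m^-1) ^+ 2.
      by rewrite -real_normK ?num_real// lerXn2r ?nnegrE ?invr_ge0 ?y_le.
    apply: le_trans yy _; rewrite /dl invfM mulrAC expr2.
    by apply: (@le_trans _ _ (1 * m^-1)); rewrite ler_wpM2r ?invr_ge0//; lra.
  have y2 : 0 <= y ^+ 2 by exact: sqr_ge0.
  move=> yd; have -> : (1 - dl) * q * y ^+ 2 / 2 = q * ((1 - dl) * y ^+ 2 / 2) by ring.
  have -> : 2 * q * sin (y / 2) ^+ 2 = q * (2 * sin (y / 2) ^+ 2) by ring.
  by rewrite ler_pM2l//; nra.
have bg e : normc (gauss q (phase theta e))%:C <= g e.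
  rewrite normc_real ger0_norm ?(ltW (gauss_gt0 _ _))// /gauss ler_expR lerN2.
  have -> : (1 - dl) * q * phase theta e ^+ 2 / 2 = (1 - dl) * (q * phase theta e ^+ 2 / 2).
    by ring.
  have y2 : 0 <= q * phase theta e ^+ 2 by rewrite (mulr_ge0 (ltW q0))// sqr_ge0.
  by rewrite ler_piMl//; lra.
have -> : (expR (- (Q theta / 2)))%:C =
    \prod_(e : {set 'I_n.+1} | #|e| == k.+1) (gauss q (phase theta e))%:C.
  by rewrite -rmorph_prod /= prod_expR_phase.
apply: le_trans (normc_prodB_le _ g0 (fun e _ => ag e) (fun e _ => bg e)) _.
rewrite prod_expR_phase.
have Q0 : 0 <= Q theta by rewrite mulr_ge0 ?phase_energy_ge0 ?ltW.
(* The bound from [phase_control], with [m ^+ 3] rounded up to [m ^+ 4] to have a simple root.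
   Unlike [m^-1] it shrinks with Q and carries the gain [1 / sqrt V]. *)
pose Y := 2 * m ^+ 2 * Num.sqrt (Q theta / V).
have Y0 : 0 <= Y by rewrite mulr_ge0 ?sqrtr_ge0// mulr_ge0 ?sqr_ge0.
have y_le_Y e : `|phase theta e| <= Y.
  rewrite -(@ler_pXn2r _ 2)// ?nnegrE// /Y exprMn sqr_sqrtr ?divr_ge0 ?(ltW V0)//.
  have := @phase_control R n k (fun x => `|x|) n_gt0 k_lt (normr0 _) (@normr_ge0 _ _)
    (@normrN _ _) (@ler_normD _ _) theta e.
  have -> : phase_energy (fun x => `|x|) k theta = phase_energy id k theta.
    by apply: eq_bigr => e' _; rewrite real_normK ?num_real.
  have N0 : 0 < 'C(n.+1, k.+1)%:R :> R by move: V0; rewrite pmulr_rgt0.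
  rewrite -ler_pdivlMr// => /le_trans; apply; rewrite -mulf_div divff ?gt_eqF// mul1r.
  rewrite -[leLHS]mulrA ler_wpM2r ?divr_ge0 ?phase_energy_ge0 ?(ltW N0)//.
  rewrite exprMn -exprM (_ : 2 ^+ 2 = 4); last by ring.
  by rewrite ler_pM2l// ler_weXn2l.
have sum_le : \sum_(e : {set 'I_n.+1} | #|e| == k.+1)
    normc (bern_cf p (phase theta e) - (gauss q (phase theta e))%:C) / g e <= 2 * Y * Q theta.
  have -> : 2 * Y * Q theta = \sum_(e : {set 'I_n.+1} | #|e| == k.+1)
      2 * (q * (Y * phase theta e ^+ 2)).
    by rewrite -!mulr_sumr /phase_energy; ring.
  apply: ler_sum => e _; rewrite ler_pdivrMr//.
  apply: le_trans (normc_bern_cf_sub_gauss p01 (y1 e)) _.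
  have y2 : phase theta e ^+ 2 <= 1.
    by rewrite -real_normK ?num_real// expr_le1.
  have g2 : 1 <= 2 * g e.
    have := expR_ge1Dx (- ((1 - dl) * q * phase theta e ^+ 2 / 2)); rewrite -/(g e).
    have q1 : q <= 1 by nra.
    have : (1 - dl) * q * phase theta e ^+ 2 <= 1; last by lra.
    have dl4 : dl <= 4^-1 by nra.
    have a0 : 0 <= (1 - dl) * q by nra.
    have a1 : (1 - dl) * q <= 1 by nra.
    have := sqr_ge0 (phase theta e); move: a0 a1 y2.
    by set a := (1 - dl) * q; set y := phase theta e ^+ 2; nra.
  have -> : `|phase theta e| ^+ 3 = `|phase theta e| * phase theta e ^+ 2.
    by rewrite exprS real_normK ?num_real.
  rewrite [leRHS]mulrAC; apply: (@le_trans _ _ (q * (Y * phase theta e ^+ 2))).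
    by rewrite ler_pM2l// ler_wpM2r ?sqr_ge0.
  by rewrite ler_peMl// mulr_ge0 ?(ltW q0)// mulr_ge0 ?sqr_ge0.
apply: le_trans (ler_wpM2l (expR_ge0 _) sum_le) _.
(* The second half of the damping: [expR x] is the slack left between the majorant and the claimed
   exponential. *)
pose x := dl * Q theta / 2.
have x0 : 0 <= x by rewrite /x divr_ge0// mulr_ge0// ltW.
have QE : Q theta = 8 * m * x by rewrite /x /dl; field.
have E1 : expR (- ((1 - (2 * m)^-1) * Q theta / 2)) =
    expR (- ((1 - dl) * Q theta / 2)) * expR x.
  by rewrite -expRD; congr expR; rewrite /x /dl; field.
rewrite E1 [leRHS]mulrCA -[(1 - dl) * q * _]mulrA ler_pM2l ?expR_gt0//.
have sV : 0 < Num.sqrt V by rewrite sqrtr_gt0.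
rewrite -[1000 * _ / _ * _]mulrAC ler_pdivlMr//.
have -> : 2 * Y * Q theta * Num.sqrt V = 4 * m ^+ 2 * Num.sqrt (Q theta) * Q theta.
  by rewrite /Y sqrtrM// sqrtrV ?(ltW V0)//; field; rewrite gt_eqF.
have -> : Num.sqrt (Q theta) = Num.sqrt (8 * m) * Num.sqrt x.
  by rewrite QE sqrtrM//; lra.
have s8 : Num.sqrt (8 * m) <= 3 * m.
  by rewrite -(@ler_pXn2r _ 2)// ?nnegrE ?sqrtr_ge0 ?sqr_sqrtr//; nra.
have sx := mul_sqrt_le_expR x0; have sx0 := sqrtr_ge0 x.
rewrite QE.
have -> : 4 * m ^+ 2 * (Num.sqrt (8 * m) * Num.sqrt x) * (8 * m * x) =
  32 * m ^+ 3 * Num.sqrt (8 * m) * (x * Num.sqrt x) by ring.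
have m3 : 0 <= 32 * m ^+ 3 by rewrite mulr_ge0// exprn_ge0//; lra.
apply: (@le_trans _ _ (32 * m ^+ 3 * (3 * m) * (2 * expR x))).
  apply: ler_pM sx; [|exact: mulr_ge0|exact: ler_wpM2l].
  by rewrite mulr_ge0// sqrtr_ge0.
have -> : 32 * m ^+ 3 * (3 * m) * (2 * expR x) = 192 * m ^+ 4 * expR x by ring.
by rewrite ler_wpM2r ?expR_ge0// ler_wpM2r ?exprn_ge0//; lra.
Qed.

End pointwise.

(** * Summation over the grid, near the origin and away from it *)

Section elementary.
Variable R : realType.
Implicit Types x : R.

Lemma bernoulli_ge x l : 0 <= x <= 1 -> 1 - l%:R * x <= (1 - x) ^+ l.
Proof.
move=> /andP[x0 x1]; elim: l => [|l IH]; first by rewrite mul0r subr0 expr0.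
have l0 : 0 <= l%:R :> R by [].
rewrite exprS; apply: (@le_trans _ _ ((1 - x) * (1 - l%:R * x))).
  by rewrite -natr1; nra.
by rewrite ler_wpM2l// subr_ge0.
Qed.

Lemma expr1D_le x l : 0 <= x -> l%:R * x <= 2^-1 -> (1 + x) ^+ l <= 1 + 2 * (l%:R * x).
Proof.
move=> x0 lx; apply: (@le_trans _ _ (expR x ^+ l)).
  by rewrite lerXn2r ?nnegrE ?expR_ge0 ?expR_ge1Dx//; lra.
rewrite -expRM_natl; set y := l%:R * x in lx *.
have y0 : 0 <= y by rewrite mulr_ge0.
have := expR_ge1Dx (- y); rewrite expRN => E.
have : expR y * (1 - y) <= 1.
  by rewrite -[leRHS](mulfV (lt0r_neq0 (expR_gt0 y))) ler_wpM2l ?expR_ge0.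
by have := expR_gt0 y; nra.
Qed.

Lemma prod_subr_ge (I : finType) (L : I -> R) (a : I -> R) x :
  0 <= x <= 1 -> (forall i, 0 <= L i) -> (forall i, a i <= x * L i) ->
  (\prod_i L i) * (1 - #|I|%:R * x) <= \prod_i (L i - a i).
Proof.
move=> x01 L0 aL; apply: (@le_trans _ _ (\prod_i (L i * (1 - x)))).
  by rewrite big_split /= prodr_const ler_wpM2l ?prodr_ge0 ?bernoulli_ge.
apply: ler_prod => i _; have := L0 i; have := aL i; case/andP: x01 => x0 x1 aLi Li.
by rewrite mulr_ge0 ?subr_ge0//=; lra.
Qed.

Lemma prod_addr_le (I : finType) (L : I -> R) (a : I -> R) x :
  0 <= x -> #|I|%:R * x <= 2^-1 -> (forall i, 0 <= L i) ->
  (forall i, 0 <= a i <= x * L i) ->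
  \prod_i (L i + a i) <= (\prod_i L i) * (1 + 2 * (#|I|%:R * x)).
Proof.
move=> x0 xI L0 aL; apply: (@le_trans _ _ (\prod_i (L i * (1 + x)))).
  apply: ler_prod => i _; have := L0 i; have /andP[a0 aLi] := aL i => Li.
  by rewrite addr_ge0//=; lra.
by rewrite big_split /= prodr_const ler_wpM2l ?prodr_ge0 ?expr1D_le.
Qed.

End elementary.

Section grid_sums.
Variables (R : realType) (n k : nat) (q : R).
Hypotheses (n_gt0 : (0 < n)%N) (k_lt : (k < n)%N) (q_gt0 : 0 < q).
Local Notation m := (n.+1%:R : R).
Local Notation N := ('C(n.+1, k.+1)%:R : R).
Local Notation X := (Num.sqrt (q * N)).

(** The factor [c] is 1 for the Gaussian itself and [1 - 1 / (2 m)] for the damped one in the error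
    term. *)
Definition gauss_coef (c : R) (i : nat) : R := c * (q * diag_coef R n k i).

Definition gauss_width (i : nat) : R := Num.sqrt (2 * pi / gauss_coef 1 i).

(** The integral of exp(-Q/2) over the whole space: the triangular substitution is unimodular, so
    only the diagonal coefficients enter. *)
Definition gauss_volume : R := \prod_(i < n.+1) gauss_width i.

Lemma diag_coef_bounds i : N / (2 * m) <= diag_coef R n k i <= N.
Proof.
have m1 : 1 <= m by rewrite ler1n.
have N0 : 0 <= N by [].
rewrite /diag_coef; case: ifP => _; last first.
  by rewrite lexx andbT ler_pdivrMr ?ler_peMr//; lra.
have aN : N <= m * 'C(n.-1, k)%:R by rewrite -natrM ler_nat binom_edges_le_pairs.
have aN' : 'C(n.-1, k)%:R <= N.
  rewrite ler_nat; apply: leq_trans (_ : 'C(n, k) <= _)%N; last by rewrite binS leq_addl.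
  by apply: leq_bin2l; rewrite leq_pred.
set a := 'C(n.-1, k)%:R in aN aN' *.
have f1 : 2^-1 <= i.+1%:R / i.+2%:R :> R.
  by rewrite ler_pdivlMr// ler_pdivrMl// -natrM ler_nat mul2n -addnn addnS ltnS leq_addr.
have f2 : i.+1%:R / i.+2%:R <= 1 :> R.
  by rewrite ler_pdivrMr// mul1r ler_nat.
have a0 : 0 <= a by [].
rewrite ler_pdivrMr; last lra.
apply/andP; split; last by apply: le_trans aN'; rewrite ler_piMr.
by set f := (_ / _) in f1 f2 *; nra.
Qed.

Lemma diag_coef_gt0 i : 0 < diag_coef R n k i.
Proof.
have /andP[+ _] := diag_coef_bounds i; apply: lt_le_trans.
by rewrite divr_gt0 ?mulr_gt0// ltr0n bin_gt0 ltnS ltnW.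
Qed.

Lemma gauss_coef_gt0 c i : 0 < c -> 0 < gauss_coef c i.
Proof. by move=> c0; rewrite !mulr_gt0 ?diag_coef_gt0. Qed.

Lemma gauss_width_gt0 i : 0 < gauss_width i.
Proof.
by rewrite sqrtr_gt0 divr_gt0 ?gauss_coef_gt0// mulr_gt0 ?pi_gt0.
Qed.

Lemma gauss_width_ge i : 2 / X <= gauss_width i.
Proof.
have a0 := @gauss_coef_gt0 1 i ltr01.
have X0 : 0 < X by rewrite sqrtr_gt0 mulr_gt0// ltr0n bin_gt0 ltnS ltnW.
have -> : gauss_width i = Num.sqrt (2 * pi) * (Num.sqrt (gauss_coef 1 i))^-1.
  by rewrite /gauss_width sqrtrM ?mulr_ge0 ?pi_ge0// sqrtrV ?(ltW a0).
apply: ler_pM; rewrite ?invr_ge0 ?(ltW X0)//.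
  rewrite -(@ler_pXn2r _ 2) ?nnegrE ?sqrtr_ge0//.
  by rewrite sqr_sqrtr ?mulr_ge0 ?pi_ge0//; have := @pi_ge2 R; lra.
have sa0 : 0 < Num.sqrt (gauss_coef 1 i) by rewrite sqrtr_gt0.
rewrite lef_pV2 ?posrE//; apply: ler_wsqrtr.
rewrite /gauss_coef mul1r ler_pM2l//.
by have /andP[] := diag_coef_bounds i.
Qed.

Lemma gauss_volume_gt0 : 0 < gauss_volume.
Proof. by apply: prodr_gt0 => i _; exact: gauss_width_gt0. Qed.

Lemma chain_phaseE c h A (f : {ffun 'I_n.+1 -> 'I_A.*2.+1}) :
  chain (gridpt h) (gauss_weight (gridpt h) (gauss_coef c) (diag_shift R n k) h) f =
  h ^+ n.+1 * expR (- (c * (q * phase_energy id k (fun i => gridpt h (f i))) / 2)).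
Proof.
rewrite /chain /gauss_weight big_split /= prodr_const card_ord; congr (_ * _).
rewrite -expR_sum sumrN; congr (expR (- _)).
rewrite /phase_energy phase_form_diag// mulrA mulr_sumr mulr_suml; apply: eq_bigr => i _.
by rewrite /gauss_coef /partial_sum; ring.
Qed.

Variables (A : nat) (h r : R).
Hypotheses (h_gt0 : 0 < h) (r_ge : 2 / (3 * m ^+ 4) <= r) (r_le : r <= m ^- 4).
Hypotheses (rA : m ^+ 2 * r <= A%:R * h).
Hypothesis h_small : forall i, 2 * h <= (m * X)^-1 * gauss_width i.
Hypotheses (m_ge2 : 2 <= m) (X_ge : m ^+ 19 <= X).
Local Notation theta f := (fun i => gridpt h (f i)).
Local Notation grid := {ffun 'I_n.+1 -> 'I_A.*2.+1}.
Local Notation gauss_term c f :=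
  (h ^+ n.+1 * expR (- (c * (q * phase_energy id k (theta f)) / 2))).

Definition near_origin (f : grid) : bool := [forall i, `|gridpt h (f i)| <= m ^- 2].

Lemma X_ge_linear j : (j <= 19)%N -> m ^+ j <= X.
Proof.
move=> j19; apply: le_trans X_ge.
by rewrite ler_weXn2l//; have := m_ge2; lra.
Qed.

Lemma X_gt0 : 0 < X.
Proof. by apply: lt_le_trans (@X_ge_linear 0 isT); rewrite expr0. Qed.

Lemma gauss_grid_sum_le :
  \sum_(f : grid) gauss_term 1 f <= gauss_volume * (1 + 2 / X).
Proof.
have X0 := X_gt0; have m2 := m_ge2.
have X4 : 4 <= X by have := @X_ge_linear 2 isT; rewrite expr2; nra.
under eq_bigr do rewrite -chain_phaseE.
have a0 i : 0 < gauss_coef 1 i by exact: gauss_coef_gt0.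
apply: le_trans (gauss_chain_sum_le n.+1 A _ h_gt0 a0) _.
have mX : m * (m * X)^-1 = X^-1 by field; rewrite !gt_eqF//; lra.
have := @prod_addr_le R 'I_n.+1 (fun i => gauss_width i) (fun=> 2 * h) (m * X)^-1.
rewrite card_ord mX; apply.
- by rewrite invr_ge0 mulr_ge0//; lra.
- by rewrite lef_pV2 ?posrE//; lra.
- by move=> i; exact/ltW/gauss_width_gt0.
- by move=> i; rewrite h_small mulr_ge0 ?ltW.
Qed.

(** Damping stretches each width by at most [c^-1]. By Bernoulli's inequality
    [(1 - 1 / (2 m)) ^+ m >= 1 / 2], so all [m] stretches together cost at most a factor 2, and the
    mesh another 2. *)
Lemma damped_gauss_grid_sum_le :
  \sum_(f : grid) gauss_term (1 - (2 * m)^-1) f <= 4 * gauss_volume.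
Proof.
have X0 := X_gt0; have m2 := m_ge2.
have X4 : 4 <= X by have := @X_ge_linear 2 isT; rewrite expr2; nra.
set c := 1 - (2 * m)^-1.
have m20 : 0 < (2 * m)^-1 by rewrite invr_gt0; lra.
have m21 : (2 * m)^-1 <= 4^-1 by rewrite lef_pV2 ?posrE; lra.
have c0 : 0 < c by rewrite subr_gt0; apply: le_lt_trans m21 _; lra.
have c1 : c <= 1 by rewrite gerBl ltW.
under eq_bigr do rewrite -chain_phaseE.
have a0 i : 0 < gauss_coef c i by exact: gauss_coef_gt0.
apply: le_trans (gauss_chain_sum_le n.+1 A _ h_gt0 a0) _.
have widthE i : Num.sqrt (2 * pi / gauss_coef c i) <= c^-1 * gauss_width i.
  rewrite -(@ger0_norm _ c^-1) ?invr_ge0 ?(ltW c0)// -sqrtr_sqr -sqrtrM ?sqr_ge0//.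
  apply: ler_wsqrtr; rewrite /gauss_coef mul1r invfM mulrCA.
  have b0 : 0 <= 2 * pi / (q * diag_coef R n k i).
    by apply/ltW; rewrite divr_gt0 ?mulr_gt0 ?pi_gt0 ?diag_coef_gt0.
  rewrite ler_wpM2r//.
  by rewrite expr2 ler_peMr ?invr_ge0 ?(ltW c0)// -[1]invr1 lef_pV2 ?posrE.
have mX : m * (m * X)^-1 = X^-1 by field; rewrite !gt_eqF//; lra.
apply: (@le_trans _ _ (\prod_(i < n.+1) (c^-1 * gauss_width i + 2 * h))).
  apply: ler_prod => i _; rewrite lerD2r widthE andbT addr_ge0 ?sqrtr_ge0//.
  by rewrite mulr_ge0 ?ltW.
have := @prod_addr_le R 'I_n.+1 (fun i => c^-1 * gauss_width i) (fun=> 2 * h) (m * X)^-1.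
rewrite card_ord mX => H; apply: le_trans (H _ _ _ _) _.
- by rewrite invr_ge0 mulr_ge0//; lra.
- by rewrite lef_pV2 ?posrE//; lra.
- by move=> i; rewrite mulr_ge0 ?invr_ge0 ?ltW ?gauss_width_gt0.
- move=> i; rewrite mulr_ge0 ?(ltW h_gt0)//=; apply: le_trans (h_small i) _.
  rewrite ler_wpM2l ?invr_ge0 ?mulr_ge0 ?(ltW X0)//.
  by rewrite ler_peMl ?(ltW (gauss_width_gt0 i))// -[1]invr1 lef_pV2 ?posrE.
rewrite big_split /= prodr_const card_ord -/gauss_volume.
have cm : (c^-1) ^+ n.+1 <= 2.
  have := @bernoulli_ge R (2 * m)^-1 n.+1; rewrite -/c.
  have -> : m * (2 * m)^-1 = 2^-1 by field; rewrite gt_eqF//; lra.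
  move=> B; rewrite exprVn -[2]invrK lef_pV2 ?posrE ?invr_gt0 ?exprn_gt0//.
  have z01 : 0 <= (2 * m)^-1 <= 1 by rewrite ltW//= (le_trans m21)//; lra.
  by apply: le_trans (B z01); lra.
have V0 := gauss_volume_gt0.
have X1 : 2 * X^-1 <= 1 by rewrite ler_pdivrMr ?mul1r//; lra.
have cm0 : 0 <= (c^-1) ^+ n.+1 by rewrite exprn_ge0// invr_ge0 ltW.
have Xi : 0 < X^-1 by rewrite invr_gt0.
set C := c^-1 ^+ _ in cm cm0 *; set W := gauss_volume in V0 *.
rewrite mulrAC ler_wpM2r ?(ltW V0)//; nra.
Qed.

(* The widths grow with [i] so that the shift caused by the earlier variables
   still leaves room for a window of half-width [r]. *)
Definition box_width (i : nat) : R := if (i < n)%N then i.+1%:R * r else m ^+ 2 * r.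

Lemma r_gt0 : 0 < r.
Proof.
apply: lt_le_trans r_ge; have := m_ge2 => m2.
by rewrite divr_gt0// mulr_gt0// exprn_gt0//; lra.
Qed.

Lemma box_width_le i : (i < n.+1)%N -> box_width i <= m ^+ 2 * r.
Proof.
move=> i_n; have r0 := r_gt0; have m2 := m_ge2; rewrite /box_width; case: ifP => // _.
rewrite ler_pM2r//; apply: (@le_trans _ _ m); first by rewrite ler_nat.
by rewrite -[leLHS]expr1 ler_weXn2l//; lra.
Qed.

Lemma sum_box_width i : (i <= n)%N ->
  \sum_(j < i) box_width j = i%:R * i.+1%:R / 2 * r.
Proof.
elim: i => [|i IH] i_n; first by rewrite big_ord0 !mul0r.
rewrite big_ord_recr /= IH ?(ltnW i_n)// /box_width i_n.
by rewrite -(natr1 i.+1) -(natr1 i); field.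
Qed.

Lemma box_width_shift i : (i < n.+1)%N ->
  r + `|diag_shift R n k i| * (\sum_(j < i) box_width j) <= box_width i.
Proof.
move=> i_n; have r0 := r_gt0; rewrite sum_box_width// /diag_shift /box_width.
have i0 : 0 <= i%:R :> R by [].
have i1 : i.+1%:R != 0 :> R by rewrite pnatr_eq0.
case: ifP => [lt_in|/negbT].
  rewrite ger0_norm ?invr_ge0//.
  have -> : i.+1%:R^-1 * (i%:R * i.+1%:R / 2 * r) = i%:R / 2 * r by field.
  by rewrite -(natr1 i) mulrDl mul1r; have := mulr_ge0 i0 (ltW r0); lra.
rewrite -leqNgt => ge_in; have -> : i = n by apply/eqP; rewrite eqn_leq ge_in -ltnS i_n.
rewrite normrN ger0_norm ?divr_ge0//.
have k1 : k.+1%:R / m <= 1 by rewrite ler_pdivrMr// mul1r ler_nat ltnS ltnW.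
have n0 : 0 <= n%:R :> R by [].
have W0 : 0 <= n%:R * m / 2 * r by rewrite !mulr_ge0// ltW.
have : k.+1%:R / m * (n%:R * m / 2 * r) <= n%:R * m / 2 * r by rewrite ler_piMl.
have : n%:R * m / 2 * r + r <= m ^+ 2 * r.
  rewrite -{2}[r]mul1r -mulrDl ler_pM2r//.
  by rewrite -(natr1 n); nra.
by move=> H2 H1; rewrite addrC; apply: le_trans H2; rewrite lerD2r.
Qed.

(** Relative to the width, the tail beyond [r] costs [6 m^5 / X]: a factor [2 m / X] from the
    smallest possible coefficient and [3 m^4 / 2] from [1 / r]. The mesh costs at most one more
    [m^5 / X]. *)
Lemma window_loss i :
  4 / (gauss_coef 1 i * r) + h <= 7 * m ^+ 5 / X * gauss_width i.
Proof.
have X0 := X_gt0; have m2 := m_ge2; have r0 := r_gt0.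
set a := gauss_coef 1 i; have a0 : 0 < a by exact: gauss_coef_gt0.
set s := Num.sqrt a; have s0 : 0 < s by rewrite sqrtr_gt0.
have s2 : s ^+ 2 = a by rewrite sqr_sqrtr ?ltW.
have w2 : 2 / s <= gauss_width i.
  rewrite /gauss_width -/a sqrtrM ?mulr_ge0 ?pi_ge0// sqrtrV ?(ltW a0)// -/s.
  rewrite ler_pM2r ?invr_gt0// -(@ler_pXn2r _ 2) ?nnegrE ?sqrtr_ge0//.
  by rewrite sqr_sqrtr ?mulr_ge0 ?pi_ge0//; have := @pi_ge2 R; lra.
have sX : X <= 2 * m * s.
  rewrite -(@ler_pXn2r _ 2) ?nnegrE ?(ltW X0)//; last by rewrite !mulr_ge0 ?(ltW s0).
  rewrite sqr_sqrtr ?mulr_ge0 ?(ltW q_gt0)// exprMn s2 /a /gauss_coef mul1r mulrCA.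
  rewrite ler_pM2l//; have /andP[lo _] := diag_coef_bounds i.
  move: lo; rewrite ler_pdivrMr; last lra.
  move=> /le_trans; apply; rewrite mulrC ler_wpM2r ?(ltW (diag_coef_gt0 i))//; nra.
have r1 : r^-1 <= 3 / 2 * m ^+ 4.
  have m4 : 0 < m ^+ 4 by rewrite exprn_gt0//; lra.
  rewrite -[leRHS]invrK lef_pV2 ?posrE ?invr_gt0 ?mulr_gt0//.
  by apply: le_trans r_ge; rewrite le_eqVlt; apply/orP; left; apply/eqP; field; lra.
have hs := h_small i; have w0 := gauss_width_gt0 i.
set w := gauss_width i in w2 hs w0 *.
have E1 : 4 / (a * r) <= 6 * m ^+ 5 / X * w.
  have -> : 4 / (a * r) = 2 * s^-1 * r^-1 * (2 / s) by rewrite -s2; field; rewrite !gt_eqF.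
  have sV : s^-1 <= 2 * m / X by rewrite ler_pdivlMr// mulrC ler_pdivrMr.
  have -> : 6 * m ^+ 5 / X = 2 * (2 * m / X) * (3 / 2 * m ^+ 4) by field; rewrite gt_eqF.
  have sV0 : 0 <= s^-1 by rewrite invr_ge0 ltW.
  have rV0 : 0 <= r^-1 by rewrite invr_ge0 ltW.
  by rewrite ler_pM// ?mulr_ge0// ler_pM// ?mulr_ge0// ler_pM2l.
have E2 : h <= m ^+ 5 / X * w.
  apply: (@le_trans _ _ ((m * X)^-1 * w)).
    by apply: le_trans hs; rewrite ler_peMl ?(ltW h_gt0)//; lra.
  rewrite ler_pM2r// invfM ler_pM2r ?invr_gt0//; apply: (@le_trans _ _ 1).
    by rewrite invf_le1//; lra.
  by rewrite -(expr0 m) ler_weXn2l//; lra.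
apply: le_trans (lerD E1 E2) _; rewrite -mulrDl ler_pM2r// -mulrDl ler_pM2r ?invr_gt0//.
by lra.
Qed.

(** The boxes lie inside [near_origin] because [m ^+ 2 * r <= m ^- 2], and the terms outside them
    are nonnegative. *)
Lemma near_gauss_sum_ge :
  gauss_volume * (1 - 7 * m ^+ 6 / X) <= \sum_(f | near_origin f) gauss_term 1 f.
Proof.
have X0 := X_gt0; have m2 := m_ge2; have r0 := r_gt0; have h0 := h_gt0.
have a0 i : 0 < gauss_coef 1 i by exact: gauss_coef_gt0.
have t0 : 0 <= 7 * m ^+ 5 / X by rewrite divr_ge0 ?mulr_ge0 ?exprn_ge0// ltW.
have t1 : 7 * m ^+ 5 / X <= 1.
  rewrite ler_pdivrMr// mul1r; apply: le_trans (@X_ge_linear 8 isT).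
  rewrite (exprD _ 3 5) ler_wpM2r ?exprn_ge0//.
  have : 2 ^+ 3 <= m ^+ 3 by rewrite lerXn2r ?nnegrE.
  by lra.
apply: (@le_trans _ _
  (\prod_(i < n.+1) (gauss_width i - 4 / (gauss_coef 1 i * r) - h))).
  under [leRHS]eq_bigr do rewrite -addrA -opprD.
  have := @prod_subr_ge R 'I_n.+1 (fun i => gauss_width i)
    (fun i => 4 / (gauss_coef 1 i * r) + h) (7 * m ^+ 5 / X).
  rewrite card_ord t0 t1 => H; apply: le_trans (H isT _ _).
  - by rewrite /gauss_volume le_eqVlt; apply/orP; left; apply/eqP; ring.
  - by move=> i; exact/ltW/gauss_width_gt0.
  - by move=> i; exact: window_loss.
have wA i : (i < n.+1)%N -> box_width i <= A%:R * h.
  by move=> i_n; apply: le_trans (box_width_le i_n) _.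
have al i : (i < n.+1)%N -> 4 / (gauss_coef 1 i * r) + h <= Num.sqrt (2 * pi / gauss_coef 1 i).
  move=> _; apply: le_trans (window_loss i) _.
  by rewrite ler_piMl ?(ltW (gauss_width_gt0 i)).
apply: le_trans (@gauss_chain_sum_ge R n.+1 A (gauss_coef 1) (diag_shift R n k) box_width h r
  h0 r0 a0 box_width_shift wA al) _.
rewrite big_mkcond [leRHS]big_mkcond; apply: ler_sum => f _.
rewrite chain_phaseE; case: ifP => [/forallP fW|_]; last first.
  by case: ifP => // _; rewrite mulr_ge0 ?expR_ge0 ?exprn_ge0// ltW.
suff -> : near_origin f by [].
apply/forallP => i; apply: le_trans (fW i) _; apply: le_trans (box_width_le (ltn_ord i)) _.
have m4 : m ^- 2 = m ^+ 2 * m ^- 4 by field; rewrite gt_eqF//; lra.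
by rewrite m4 ler_wpM2l// exprn_ge0//; lra.
Qed.

Lemma near_gauss_sum_dist :
  `|\sum_(f | near_origin f) gauss_term 1 f - gauss_volume| <= 7 * m ^+ 6 / X * gauss_volume.
Proof.
have X0 := X_gt0; have m2 := m_ge2; have V0 := gauss_volume_gt0; have h0 := h_gt0.
have lo := near_gauss_sum_ge; have up := gauss_grid_sum_le.
have sub : \sum_(f | near_origin f) gauss_term 1 f <= \sum_(f : grid) gauss_term 1 f.
  rewrite big_mkcond; apply: ler_sum => f _; case: ifP => // _.
  by rewrite mulr_ge0 ?expR_ge0 ?exprn_ge0// ltW.
have c : 2 / X <= 7 * m ^+ 6 / X.
  rewrite ler_pM2r ?invr_gt0//.
  have : m ^+ 0 <= m ^+ 6 by rewrite ler_weXn2l//; lra.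
  by rewrite expr0; lra.
have cV : gauss_volume * (2 / X) <= 7 * m ^+ 6 / X * gauss_volume.
  by rewrite mulrC ler_pM2r.
rewrite ler_norml; move: lo up; rewrite mulrBr mulrDr !mulr1 (mulrC _ (7 * _ / X)) => lo up.
by apply/andP; split; lra.
Qed.

Variable p : R.
Hypotheses (p_gt0 : 0 < p) (p_lt1 : p < 1) (qE : q = p * (1 - p)).
Hypothesis hM : A.*2.+1%:R * h = 2 * pi.
Local Open Scope complex_scope.
Local Notation bern_prod f :=
  (\prod_(e : {set 'I_n.+1} | #|e| == k.+1) bern_cf p (phase (theta f) e)).

Lemma gauss_volume_ge : (2 / X) ^+ n.+1 <= gauss_volume.
Proof.
have -> : (2 / X) ^+ n.+1 = \prod_(i < n.+1) (2 / X) by rewrite prodr_const card_ord.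
by apply: ler_prod => i _; rewrite divr_ge0 ?sqrtr_ge0//= gauss_width_ge.
Qed.

Lemma far_sum_le :
  \sum_(f : grid | ~~ near_origin f) h ^+ n.+1 * normc (bern_prod f) <= gauss_volume / X.
Proof.
have X0 := X_gt0; have m2 := m_ge2; have h0 := h_gt0; have pi0 := pi_gt0 R.
set E := expR (- (X ^+ 2 / (72 * m ^+ 7))).
have bound f : ~~ near_origin f -> normc (bern_prod f) <= E.
  move=> /forallPn[v]; rewrite -ltNge => fv.
  rewrite /E sqr_sqrtr ?mulr_ge0 ?(ltW q_gt0)// qE.
  apply: (@prod_bern_cf_far R n k p n_gt0 k_lt p_gt0 p_lt1 _ v); rewrite fv /=.
  apply: (@le_trans _ _ (A%:R * h)); last first.
    have : (A%:R * 2 + 1) * h = 2 * pi by rewrite -hM -(natr1 A.*2) -muln2 natrM.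
    by have := @pihalf_lt2 R; lra.
  rewrite normrM (gtr0_norm h0) ler_pM2r// ler_norml lerBrDr addrC subrr ler0n /=.
  by rewrite lerBlDr -natrD ler_nat addnn -ltnS; exact: ltn_ord.
apply: (@le_trans _ _ (\sum_(f : grid) h ^+ n.+1 * E)).
  rewrite big_mkcond; apply: ler_sum => f _; case: ifP => [/bound fE|_].
    by rewrite ler_wpM2l// exprn_ge0// ltW.
  by rewrite mulr_ge0 ?expR_ge0// exprn_ge0// ltW.
rewrite sumr_const card_ffun !card_ord -[leLHS]mulr_natl mulrA natrX -exprMn hM.
(* The far bound has to beat both the torus volume [(2 pi)^m] and the small main term, which may be
   as low as [(2 / X)^m]. Here the power 19 is spent: [72 m^7 (4 m + 1) <= m^19 <= X]. *)
have E1 : E <= expR (- (4 * X) *+ n.+1) * X^-1.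
  have Xe : expR (- X) <= X^-1.
    by rewrite expRN lef_pV2 ?posrE ?expR_gt0// (le_trans _ (expR_ge1Dx X))// lerDr.
  apply: le_trans (ler_wpM2l (expR_ge0 _) Xe); rewrite -expRD ler_expR.
  have m7 : 0 < 72 * m ^+ 7 by rewrite mulr_gt0// exprn_gt0//; lra.
  have : (4 * m + 1) * X <= X ^+ 2 / (72 * m ^+ 7).
    rewrite ler_pdivlMr// mulrAC expr2 ler_pM2r//.
    apply: le_trans (@X_ge_linear 19 isT); rewrite (exprD _ 12 7) mulrCA mulrA.
    rewrite ler_wpM2r ?exprn_ge0//.
    have : 2 ^+ 11 <= m ^+ 11 by rewrite lerXn2r ?nnegrE.
    have -> : 2 ^+ 11 = 2048 :> R by ring.
    by rewrite (exprS _ 11); set z := m ^+ 11; nra.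
  by rewrite -[_ *+ n.+1]mulr_natl; set z := X ^+ 2 / _; lra.
have pp : 0 <= 2 * pi :> R by lra.
apply: le_trans (ler_wpM2l (exprn_ge0 _ pp) E1) _.
rewrite mulrA ler_pM2r ?invr_gt0//; apply: le_trans gauss_volume_ge.
rewrite -[_ *+ n.+1]mulr_natl expRM_natl -exprMn.
have e1 : 2 * pi * expR (- (4 * X)) <= 2 / X.
  rewrite expRN ler_pdivrMr ?expR_gt0// mulrAC ler_pdivlMr//.
  by have := expR_ge1Dx (4 * X); have := @pihalf_lt2 R; nra.
have e0 : 0 <= 2 * pi * expR (- (4 * X)) by rewrite mulr_ge0 ?expR_ge0.
by rewrite lerXn2r// nnegrE// (le_trans e0).
Qed.

Lemma near_sum_le :
  \sum_(f : grid | near_origin f)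
    h ^+ n.+1 * normc (bern_prod f - (expR (- (q * phase_energy id k (theta f) / 2)))%:C) <=
  4000 * m ^+ 4 / X * gauss_volume.
Proof.
have X0 := X_gt0; have h0 := h_gt0; have m2 := m_ge2.
have c0 : 0 <= 1000 * m ^+ 4 / X.
  apply: divr_ge0 (ltW X0); apply: mulr_ge0; first exact: ler0n.
  by apply: exprn_ge0; exact: ler0n.
apply: (@le_trans _ _ (1000 * m ^+ 4 / X *
    \sum_(f : grid) gauss_term (1 - (2 * m)^-1) f)); last first.
  apply: le_trans (ler_wpM2l c0 damped_gauss_grid_sum_le) _.
  by rewrite le_eqVlt; apply/orP; left; apply/eqP; field; rewrite gt_eqF.
rewrite mulr_sumr big_mkcond; apply: ler_sum => f _; case: ifP => [/forallP fB|_]; last first.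
  by rewrite mulr_ge0// mulr_ge0 ?expR_ge0// exprn_ge0// ltW.
rewrite [leRHS]mulrCA ler_wpM2l ?exprn_ge0 ?(ltW h0)// qE.
exact: (@prod_bern_cf_near R n k p n_gt0 k_lt p_gt0 p_lt1 _ fB).
Qed.

(** Three errors add up: Gaussian replacement near the origin, the discarded far part, and the
    Gaussian sum itself, with coefficients 4000, 1 and 7. *)
Lemma bern_prod_sum_dist :
  normc ((h ^+ n.+1)%:C * (\sum_(f : grid) bern_prod f) - gauss_volume%:C) <=
  5000 * m ^+ 6 / X * gauss_volume.
Proof.
have X0 := X_gt0; have h0 := h_gt0; have m2 := m_ge2; have V0 := gauss_volume_gt0.
have hn : 0 <= h ^+ n.+1 by rewrite exprn_ge0// ltW.
pose e (f : grid) := expR (- (q * phase_energy id k (theta f) / 2)).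
have -> : (h ^+ n.+1)%:C * (\sum_(f : grid) bern_prod f) - gauss_volume%:C =
    \sum_(f : grid | near_origin f) (h ^+ n.+1)%:C * (bern_prod f - (e f)%:C)
    + \sum_(f : grid | ~~ near_origin f) (h ^+ n.+1)%:C * bern_prod f
    + (\sum_(f | near_origin f) gauss_term 1 f - gauss_volume)%:C.
  rewrite rmorphB rmorph_sum /= addrA; congr (_ - _).
  rewrite (bigID near_origin) /= mulrDr !mulr_sumr [RHS]addrAC; congr (_ + _).
  rewrite -big_split; apply: eq_bigr => f _ /=.
  by rewrite mul1r mulrBr [in RHS]rmorphM subrK.
have normh z : normc ((h ^+ n.+1)%:C * z) = h ^+ n.+1 * normc z.
  by rewrite normcM normc_real ger0_norm.
have N1 := near_sum_le; have N2 := far_sum_le; have N3 := near_gauss_sum_dist.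
apply: (@le_trans _ _ (4000 * m ^+ 4 / X * gauss_volume + gauss_volume / X
  + 7 * m ^+ 6 / X * gauss_volume)); last first.
  have m46 : m ^+ 4 <= m ^+ 6 by rewrite ler_weXn2l//; lra.
  have m06 : 1 <= m ^+ 6 by rewrite -(expr0 m) ler_weXn2l//; lra.
  have -> : 4000 * m ^+ 4 / X * gauss_volume + gauss_volume / X
    + 7 * m ^+ 6 / X * gauss_volume =
    (4000 * m ^+ 4 + 1 + 7 * m ^+ 6) / X * gauss_volume by field; rewrite gt_eqF.
  by rewrite ler_wpM2r ?(ltW V0)// ler_wpM2r ?invr_ge0 ?(ltW X0)//; lra.
apply: le_trans (normcD _ _) _; rewrite normc_real lerD//.
apply: le_trans (normcD _ _) _; rewrite lerD//.
  by apply: le_trans (normc_sum_le _ _ _) _; under eq_bigr do rewrite normh.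
by apply: le_trans (normc_sum_le _ _ _) _; under eq_bigr do rewrite normh.
Qed.

End grid_sums.

(** * The Gaussian volume as the asymptotic formula *)

Section asymptotics.
Variable R : realType.
Implicit Types (n k d : nat) (p q : R).

Lemma powR_half_sqr (x : R) l : 0 <= x -> (x `^ (l%:R / 2)) ^+ 2 = x ^+ l.
Proof.
by move=> x0; rewrite -powR_mulrn ?powR_ge0// -powRrM divfK// powR_mulrn.
Qed.

Lemma prod_ratio n : \prod_(i < n) (i.+1%:R / i.+2%:R) = n.+1%:R^-1 :> R.
Proof.
elim: n => [|n IH]; first by rewrite big_ord0 invr1.
by rewrite big_ord_recr /= IH mulrA mulVf ?mul1r// pnatr_eq0.
Qed.

Lemma prod_diag_coef n k : (k < n)%N ->
  \prod_(i < n.+1) diag_coef R n k i = 'C(n.-1, k)%:R ^+ n * 'C(n, k)%:R / k.+1%:R.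
Proof.
move=> kn; rewrite big_ord_recr /= {2}/diag_coef ltnn.
rewrite (eq_bigr (fun i : 'I_n => 'C(n.-1, k)%:R * (i.+1%:R / i.+2%:R))) => [|i _]; last first.
  by rewrite /diag_coef /= ltn_ord.
rewrite big_split /= prodr_const card_ord prod_ratio.
have -> : 'C(n.+1, k.+1)%:R = n.+1%:R * 'C(n, k)%:R / k.+1%:R :> R.
  by rewrite -natrM (mul_bin_diag n.+1 k) natrM mulrAC divff ?mul1r// pnatr_eq0.
by rewrite -!mulrA mulKf// pnatr_eq0.
Qed.

Lemma gauss_volume_sqr n k q : (0 < n)%N -> (k < n)%N -> 0 < q ->
  gauss_volume n k q ^+ 2 =
  (2 * pi / q) ^+ n.+1 * (k.+1%:R / 'C(n, k)%:R) * 'C(n.-1, k)%:R ^- n.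
Proof.
move=> n0 kn q0; rewrite /gauss_volume -prodrXl.
rewrite (eq_bigr (fun i : 'I_n.+1 => 2 * pi / q * (diag_coef R n k i)^-1)) => [|i _]; last first.
  rewrite sqr_sqrtr /gauss_coef ?mul1r ?invfM ?mulrA//.
  rewrite !mulr_ge0 ?pi_ge0 ?invr_ge0 ?(ltW q0)//.
  exact/ltW/diag_coef_gt0.
rewrite big_split /= prodr_const card_ord -[RHS]mulrA; congr (_ * _).
rewrite prodfV prod_diag_coef// !invfM invrK.
by rewrite [RHS]mulrC -mulrA; congr (_ * _); rewrite mulrC.
Qed.

Lemma asymptotic_countE n k d : (0 < n)%N -> (k < n)%N ->
  let p := edge_density R n.+1 k.+1 d in 0 < p -> p < 1 ->
  asymptotic_count R n.+1 k.+1 d *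
    ((2 * pi) ^+ n.+1 * (p ^+ edge_count n.+1 k.+1 d * (1 - p) ^+ nonedge_count n.+1 k.+1 d)) =
  gauss_volume n k (p * (1 - p)).
Proof.
move=> n0 kn p p0 p1; set E := edge_count _ _ _; set F := nonedge_count _ _ _.
have q0 : 0 < p * (1 - p) by rewrite mulr_gt0 ?subr_gt0.
have pi0 := pi_gt0 R; have tp0 : 0 < 2 * pi :> R by rewrite mulr_gt0.
have b0 : 0 < 'C(n, k)%:R :> R by rewrite ltr0n bin_gt0 ltnW.
have a0 : 0 < 'C(n.-1, k)%:R :> R by rewrite ltr0n bin_gt0; case: n n0 kn {p p0 p1 E F q0 b0}.
have pE : 0 < p ^+ E by rewrite exprn_gt0.
have pF : 0 < (1 - p) ^+ F by rewrite exprn_gt0// subr_gt0.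
have -> : asymptotic_count R n.+1 k.+1 d =
  ((2 * pi * p * (1 - p)) `^ (n.+1%:R / 2) * p ^+ E * (1 - p) ^+ F)^-1
  * (k.+1%:R / 'C(n, k)%:R) `^ (1%:R / 2) * ('C(n.-1, k)%:R^-1) `^ (n%:R / 2).
  rewrite /asymptotic_count -/p -/E -/F !subn1 subn2 /=.
  by rewrite [1 / 2 * _]mulrC [n%:R * (1 / 2)]mulrA mulr1 [1 / 'C(_, _)%:R]mul1r.
have x0 : 0 < 2 * pi * p * (1 - p) by rewrite -mulrA mulr_gt0.
set u := _ `^ (n.+1%:R / 2); set v := _ `^ (1%:R / 2); set w := _ `^ (n%:R / 2).
have u0 : 0 < u by rewrite powR_gt0.
have -> : (u * p ^+ E * (1 - p) ^+ F)^-1 * v * w * ((2 * pi) ^+ n.+1 * (p ^+ E * (1 - p) ^+ F)) =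
    (2 * pi) ^+ n.+1 * v * w / u.
  by field; rewrite !gt_eqF.
(* Both sides are nonnegative, and squaring turns the half-integral real powers into natural
   ones. *)
apply: (@pexpIrn _ 2) => //; rewrite ?nnegrE.
- by rewrite divr_ge0 ?mulr_ge0 ?powR_ge0 ?exprn_ge0// ltW.
- exact/ltW/gauss_volume_gt0.
rewrite gauss_volume_sqr// !exprMn exprVn /u /v /w !powR_half_sqr ?invr_ge0 ?divr_ge0 ?(ltW x0)//.
clear u v w u0; clearbody p.
rewrite expr1 -[2 * pi * p * _]mulrA !exprMn !exprVn !exprMn; field.
by rewrite !gt_eqF ?exprn_gt0// subr_gt0.
Qed.

End asymptotics.

(** * Choice of the grid and conclusion *)

Section counting_estimate.
Variable R : realType.

(* The grid has at least [N] points per period, so that aliasing is excluded,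
   and is fine compared with the width of the peak. *)
Lemma exists_grid (m X : R) (M N : nat) : m = M%:R -> 2 <= m -> 1 <= X ->
  exists A : nat, exists2 hr : R * R, (N <= A.*2)%N &
    [/\ 0 < hr.1, A.*2.+1%:R * hr.1 = 2 * pi, hr.1 <= (m * X ^+ 2)^-1,
        2 / (3 * m ^+ 4) <= hr.2 /\ hr.2 <= m ^- 4 & m ^+ 2 * hr.2 <= A%:R * hr.1].
Proof.
move=> mE m2 X1; have pi2 := @pihalf_lt2 R; have pi1 := @pihalf_ge1 R.
(* [cos (pi / 2) = 0] and the quadratic lower bound for cosine give [pi^2 >= 8]. The bound [pi >= 2]
   is too weak for [2 / 3 <= r m^4], where [r m^4] is about [pi / 4]. *)
have pi28 : 28 / 10 <= pi :> R.
  have := @cos_ge R (pi / 2) (ltac:(lra)); rewrite cos_pihalf => c.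
  have p8 : 8 <= pi ^+ 2 :> R by move: c; set x := pi; lra.
  by move: p8 pi1 pi2; set x : R := pi; nra.
have mX0 : 0 <= m * X ^+ 2 by rewrite mulr_ge0 ?sqr_ge0//; lra.
have [J0 J0E] : exists J0 : nat, m * X ^+ 2 <= J0%:R.
  by exists (Num.Def.archi_bound (m * X ^+ 2)); apply/ltW/archi_boundP.
(* The window [r] will be [J] meshes long; with [A = 4 m^4 J] it is close to [pi / (4 m^4)] however
   fine the grid is. *)
pose J := (J0 + N).+1; pose A := (4 * M ^ 4 * J)%N; pose h : R := 2 * pi / A.*2.+1%:R.
have J1 : 1 <= J%:R :> R by rewrite ler1n.
have JX : m * X ^+ 2 <= J%:R by rewrite (le_trans J0E)// ler_nat leqW// leq_addr.
have m4 : 16 <= m ^+ 4.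
  have -> : 16 = 2 ^+ 4 :> R by ring.
  by rewrite lerXn2r ?nnegrE//; lra.
have AE : A%:R = 4 * m ^+ 4 * J%:R :> R by rewrite /A (natrM _ _ J) natrM natrX mE.
have A2E : A.*2.+1%:R = 8 * m ^+ 4 * J%:R + 1 :> R.
  by rewrite -(natr1 A.*2) -muln2 natrM AE; ring.
have mJ : J%:R <= m ^+ 4 * J%:R by rewrite ler_peMl//; lra.
have z16 : 16 <= m ^+ 4 * J%:R by nra.
set z := m ^+ 4 * J%:R in mJ z16; have zE : 8 * m ^+ 4 * J%:R = 8 * z by rewrite /z; ring.
have A0 : 0 < A.*2.+1%:R :> R by [].
have h0 : 0 < h by rewrite divr_gt0// mulr_gt0// pi_gt0.
exists A, (h, J%:R * h).
  have : (0 < M ^ 4)%N by rewrite expn_gt0 -(@ltr0n R) -mE; apply/orP; left; lra.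
  move=> M4; apply: (@leq_trans J); first by rewrite leqW ?leq_addl.
  apply: (@leq_trans A); last by rewrite -addnn leq_addr.
  by rewrite /A leq_pmull// muln_gt0.
split => //=.
- by rewrite /h mulrC divfK// gt_eqF.
- apply: (@le_trans _ _ J%:R^-1); last first.
    have mX1 : 0 < m * X ^+ 2 by rewrite mulr_gt0 ?exprn_gt0//; lra.
    by rewrite lef_pV2 ?posrE//; lra.
  rewrite -[leRHS]mul1r /h ler_pdivrMr// mulrAC ler_pdivlMr; last lra.
  by rewrite A2E zE; nra.
- have m40 : 0 < m ^+ 4 by lra.
  have e : J%:R = z / m ^+ 4 by rewrite /z mulrAC divff ?mul1r// gt_eqF.
  have -> : J%:R * h = (z * (2 * pi) / (8 * z + 1)) / m ^+ 4.
    by rewrite /h A2E zE e; field; rewrite !gt_eqF//; lra.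
  split.
    rewrite (invfM 3) [leLHS]mulrA ler_pM2r ?invr_gt0// ler_pdivlMr; last lra.
    by nra.
  rewrite -[leRHS]mul1r ler_pM2r ?invr_gt0// ler_pdivrMr; last lra.
  by nra.
rewrite AE mulrA ler_pM2r//; apply: (@le_trans _ _ (m ^+ 4 * J%:R)); last by nra.
by rewrite ler_wpM2r// ler_weXn2l//; lra.
Qed.

(** The cell volume [h ^+ n.+1] times the number of grid points is [(2 pi) ^+ n.+1], so the
    auxiliary grid leaves no trace in the estimate. *)
Lemma regular_count_dist n k d (p : R) E : (0 < n)%N -> (k < n)%N ->
  (n.+1 * d = E * k.+1)%N -> (E <= 'C(n.+1, k.+1))%N -> (d <= 'C(n.+1, k.+1))%N ->
  0 < p -> p < 1 -> p * 'C(n.+1, k.+1)%:R = E%:R -> p * 'C(n, k)%:R = d%:R ->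
  let X := Num.sqrt (p * (1 - p) * 'C(n.+1, k.+1)%:R) in
  n.+1%:R ^+ 19 <= X ->
  `|(2 * pi) ^+ n.+1 * (p ^+ E * (1 - p) ^+ ('C(n.+1, k.+1) - E))
      * (num_regular_uniform n.+1 k.+1 d)%:R - gauss_volume n k (p * (1 - p))| <=
  5000 * n.+1%:R ^+ 6 / X * gauss_volume n k (p * (1 - p)).
Proof.
move=> n0 kn nd EN dN p0 p1 pN pd X Xge.
have m2 : 2 <= n.+1%:R :> R by rewrite ler_nat ltnS.
have X1 : 1 <= X by apply: le_trans Xge; rewrite exprn_ege1//; lra.
have [A [[h r] /= NA [h0 hM hX [r_ge r_le] rA]]] :=
  @exists_grid n.+1%:R X n.+1 'C(n.+1, k.+1) erefl m2 X1.
have q0 : 0 < p * (1 - p) by rewrite mulr_gt0 ?subr_gt0.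
have h_small i : 2 * h <= (n.+1%:R * X)^-1 * gauss_width n k (p * (1 - p)) i.
  apply: (@le_trans _ _ ((n.+1%:R * X)^-1 * (2 / X))); last first.
    by rewrite ler_wpM2l ?gauss_width_ge// invr_ge0 mulr_ge0//; lra.
  have -> : (n.+1%:R * X)^-1 * (2 / X) = 2 * (n.+1%:R * X ^+ 2)^-1.
    by rewrite expr2 !invfM; ring.
  by rewrite ler_pM2l.
have := bern_prod_sum_dist n0 kn q0 h0 r_ge r_le rA h_small m2 Xge p0 p1 erefl hM.
have -> : h = 2 * pi / A.*2.+1%:R by rewrite -hM mulrAC divff ?mul1r// gt_eqF.
rewrite (fourier_inversion nd EN dN NA pN pd) -rmorphM -rmorphB normc_real.
by congr (`|_ - _| <= _); rewrite !mulrA -exprMn divfK.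
Qed.

End counting_estimate.

Theorem theorem1p5 (R : realType) :
  exists2 c : R, 0 < c &
    forall n k d : nat,
      (2 <= n)%N -> (1 <= k <= n)%N -> (1 <= d <= 'C(n - 1, k - 1))%N ->
      (k %| n * d)%N ->
      let m := minn (edge_count n k d) (nonedge_count n k d) in
      n%:R `^ c <= m%:R ->
      exists2 delta : R,
        (num_regular_uniform n k d)%:R
          = asymptotic_count R n k d * (1 + delta)
        & `|delta| <= n%:R `^ c / Num.sqrt m%:R.
Proof.
(* The power 40 serves twice: its square root [n^20] is at least [2 n^19], as required of [X], and
   [n^40] exceeds [10000 n^6], the final relative error times [sqrt m]. *)
exists 40%:R => // -[//|n] [//|k] d n2 kn dB nd m nm; rewrite !subn1 /= in dB.
have n0 : (0 < n)%N by [].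
set E := edge_count n.+1 k.+1 d in m nm *; set F := nonedge_count n.+1 k.+1 d in m nm *.
have EN : (E <= 'C(n.+1, k.+1))%N.
  by apply: edge_count_le => //; rewrite !subn1; case/andP: dB.
have EF : (E + F = 'C(n.+1, k.+1))%N by rewrite /F /nonedge_count subnKC.
have nm40 : n.+1%:R ^+ 40 <= m%:R :> R by rewrite -powR_mulrn.
set v : R := n.+1%:R in nm nm40 *.
have v2 : 2 <= v by rewrite ler_nat.
have m_gt1 : 1 < m%:R :> R.
  by apply: lt_le_trans nm40; rewrite exprn_egt1//; lra.
have mE : m%:R <= E%:R :> R by rewrite ler_nat geq_minl.
have mF : m%:R <= F%:R :> R by rewrite ler_nat geq_minr.
(* If every edge were the full vertex set, there would be only one possible edge, so the minimum
   could not exceed 1. *)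
have k_lt : (k < n)%N.
  rewrite ltnNge; apply/negP => nk; have kE : k = n by apply/eqP; rewrite eqn_leq nk andbT.
  by move: mE mF m_gt1; rewrite !ler_nat ltr1n => *; move: EF; rewrite kE binn; lia.
set N : R := 'C(n.+1, k.+1)%:R.
have NE : N = E%:R + F%:R by rewrite -natrD EF.
have N0 : 0 < N by lra.
have ndE : (n.+1 * d = E * k.+1)%N by rewrite edge_countK.
pose p := edge_density R n.+1 k.+1 d.
have k0 : k.+1%:R != 0 :> R by rewrite pnatr_eq0.
have v0 : v != 0 by rewrite gt_eqF//; lra.
have pE : p = E%:R / N.
  by rewrite /p /edge_density ndE natrM -/N [E%:R * _]mulrC -mulf_div divff// mul1r.
have pN : p * N = E%:R by rewrite pE divfK ?gt_eqF.
have p0 : 0 < p by rewrite pE divr_gt0//; lra.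
have p1 : p < 1 by rewrite pE ltr_pdivrMr//; lra.
have pd : p * 'C(n, k)%:R = d%:R.
  apply: (mulfI v0); rewrite -[RHS]natrM ndE natrM -pN mulrCA -natrM.
  by rewrite (mul_bin_diag n.+1 k) natrM [k.+1%:R * _]mulrC mulrA.
have dN : (d <= 'C(n.+1, k.+1))%N.
  by case/andP: dB => _ /leq_trans; apply; rewrite binS leq_addl.
pose X := Num.sqrt (p * (1 - p) * N).
(* The right-hand side is [E F / (E + F)], half the harmonic mean, hence even at least [m / 2]; the
   divisor 4 is taken for its rational root. *)
have V_ge : m%:R / 4 <= p * (1 - p) * N.
  have -> : p * (1 - p) * N = E%:R * F%:R / N.
    by rewrite pE NE; field; rewrite -NE gt_eqF.
  have h1 : m%:R * F%:R <= E%:R * F%:R :> R by rewrite ler_wpM2r.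
  have h2 : E%:R * m%:R <= E%:R * F%:R :> R by rewrite ler_wpM2l.
  by rewrite ler_pdivlMr// NE mulrAC mulrDr (mulrC m%:R E%:R); have := mulr_ge0 (ler0n R E) (ler0n R F); lra.
have X_ge : Num.sqrt m%:R / 2 <= X.
  have -> : 2 = Num.sqrt 4 :> R.
    by rewrite (_ : 4 = 2 ^+ 2) ?sqrtr_sqr ?ger0_norm//; ring.
  by rewrite -sqrtrV// -sqrtrM// ler_wsqrtr.
have sm0 : 0 < Num.sqrt m%:R :> R by rewrite sqrtr_gt0; lra.
have X0 : 0 < X by apply: lt_le_trans X_ge; rewrite divr_gt0.
have X19 : v ^+ 19 <= X.
  apply: le_trans X_ge; rewrite ler_pdivlMr//.
  apply: (@le_trans _ _ (v ^+ 20)); first by rewrite [leRHS]exprSr ler_wpM2l// exprn_ge0.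
  have -> : v ^+ 20 = Num.sqrt (v ^+ 40).
    by rewrite (exprM v 20 2) sqrtr_sqr ger0_norm// exprn_ge0//; lra.
  exact: ler_wsqrtr.
have dist := regular_count_dist n0 k_lt ndE EN dN p0 p1 pN pd X19.
have asymE := asymptotic_countE n0 k_lt p0 p1.
set W := gauss_volume n k _ in dist asymE.
have W0 : 0 < W by apply: gauss_volume_gt0; rewrite // mulr_gt0 ?subr_gt0.
set a := asymptotic_count R n.+1 k.+1 d in asymE *.
set cnt : R := (num_regular_uniform _ _ _)%:R in dist *.
rewrite -/p -/E -/F in asymE; rewrite -/F in dist.
set w := (2 * pi) ^+ n.+1 * _ in asymE dist.
have w0 : w != 0 by apply/eqP => w0; move: W0; rewrite -asymE w0 mulr0 ltxx.
have a0 : a != 0 by apply/eqP => a0; move: W0; rewrite -asymE a0 mul0r ltxx.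
exists (w * cnt / W - 1).
  by rewrite [1 + _]addrC subrK -asymE [w * cnt]mulrC -mulf_div (divff w0) mulr1 mulrC divfK.
have -> : w * cnt / W - 1 = (w * cnt - W) / W by rewrite mulrBl divff// gt_eqF.
rewrite normrM (gtr0_norm (_ : 0 < W^-1)) ?invr_gt0// ler_pdivrMr//.
apply: le_trans dist _; rewrite ler_wpM2r ?(ltW W0)// powR_mulrn//.
rewrite ler_pdivrMr// mulrAC ler_pdivlMr//; apply: (@le_trans _ _ (v ^+ 40 * (Num.sqrt m%:R / 2))).
  have v1 : 1 <= v by lra.
  have v40 : v ^+ 14 * v ^+ 6 <= v ^+ 40 by rewrite -exprD ler_weXn2l.
  have v6 : 0 < v ^+ 6 by rewrite exprn_gt0// (lt_le_trans ltr01).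
  have v14 : 16384 <= v ^+ 14.
    have -> : 16384 = 2 ^+ 14 :> R by ring.
    by rewrite lerXn2r ?nnegrE//; lra.
  rewrite [leRHS]mulrCA [leLHS]mulrC ler_pM2l// ler_pdivlMr//.
  apply: le_trans v40; apply: le_trans (ler_wpM2r (ltW v6) v14).
  by rewrite mulrAC ler_pM2r// -natrM ler_nat.
by rewrite ler_wpM2l// exprn_ge0.
Qed.
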